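(* Let $R$ be a commutative Noetherian local ring. If there exists a non-zero finitely generated $R$-module $M$ such that $\operatorname{qid}_R M<\infty$ and $\dim R=\dim M+\operatorname{grade} M$, then $R$ is Cohen-Macaulay.
   Context: $\operatorname{grade} M:=\inf\{i\ge 0:\operatorname{Ext}^i_R(M,R)\ne 0\}$, and $\dim$ denotes Krull dimension. For a complex $X$ of $R$-modules (homologically indexed), $\sup X=\sup\{i: X_i\ne 0\}$, $\inf X=\inf\{i: X_i\neq 0\}$, $\operatorname{hinf}X=\inf\{i: H_i(X)\neq 0\}$. $X$ is bounded above if $\sup X<\infty$, and bounded if $\sup X-\inf X<\infty$. A quasi-injective resolution of $M$ is a bounded above complex $I$ of injective $R$-modules (not required to be finitely generated) such that for all $i\le\sup I$ there exist non-negative integers $b_i$, not all zero, with $H_i(I)\cong M^{\oplus b_i}$. The quasi-injective dimension of $M\ne0$ is $\operatorname{qid}_R M=\inf\{\operatorname{hinf}I-\inf I : I\text{ is a bounded quasi-injective resolution of }M\}$; it is $\infty$ if $M$ has no bounded quasi-injective resolution. *)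

(* Defs.v *)
From HB Require Import structures.
From mathcomp Require Import all_boot all_order all_algebra.
From mathcomp Require Import ring_quotient generic_quotient.
From mathcomp Require Import zify.
From mathcomp Require Import boolp classical_sets functions constructive_ereal.

Set Implicit Arguments.
Unset Strict Implicit.
Unset Printing Implicit Defensive.
Import Order.TTheory GRing.Theory Num.Theory.
Local Open Scope ring_scope.
Local Open Scope quotient_scope.

(* Suprema and infima are taken in the complete chain of extended integers,   *)
(* with sup of the empty set equal to -oo and inf of the empty set to +oo.    *)
Definition esup (A : set (\bar int)) : \bar int := supremum -oo%E A.
Definition einf (A : set (\bar int)) : \bar int := infimum +oo%E A.

Section Modules.
Variable R : comNzRingType.
Implicit Types (U V M N : lmodType R).

Definition nonzero_module M : Prop := exists x : M, x != 0.

Definition iso_module M N : Prop := exists f : {linear M -> N}, bijective f.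

Definition spans V (s : seq V) (x : V) : Prop :=
  exists c : 'I_(size s) -> R, x = \sum_(i < size s) c i *: s`_i.

Definition finitely_generated M : Prop :=
  exists s : seq M, forall x, spans s x.

Definition injective_module N : Prop :=
  forall U V (f : {linear U -> V}) (g : {linear U -> N}),
    injective f -> exists h : {linear V -> N}, h \o f =1 g.

Definition projective_module N : Prop :=
  forall U V (f : {linear U -> V}) (g : {linear N -> V}),
    (forall v, exists u, f u = v) -> exists h : {linear N -> U}, f \o h =1 g.

Section Submodule.
Variables (V : lmodType R) (W : submodClosed V).

Definition submodule : Type := {x : V | x \in W}.
HB.instance Definition _ := SubChoice.on submodule.
HB.instance Definition _ := [SubChoice_isSubLmodule of submodule by <:].

Definition submodule_zmodClosed : zmodClosed V :=
  HB.pack (W : {pred V}) (GRing.isZmodClosed.Build V (W : {pred V})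
    (GRing.submod_closedB (submodClosedP W))).

Definition quotient_module : Type := {ideal_quot submodule_zmodClosed}.
HB.instance Definition _ := GRing.Zmodule.on quotient_module.

Local Notation Q := quotient_module.

Definition quotient_pi : V -> Q := \pi_{ideal_quot submodule_zmodClosed}.
Definition quotient_scale (a : R) (x : Q) : Q := quotient_pi (a *: repr x).

Fact quotient_piP x y : (quotient_pi x = quotient_pi y) <-> (x - y \in W).
Proof.
have := Quotient.idealrBE submodule_zmodClosed x y.
rewrite /quotient_pi => e; split => [exy|Wxy].
  by move: e; rewrite exy eqxx.
by apply/eqP; rewrite -e.
Qed.

Fact quotient_pi_surj (q : Q) : exists x, quotient_pi x = q.
Proof. by exists (repr q); exact: reprK. Qed.

Fact quotient_piD x y : quotient_pi (x + y) = quotient_pi x + quotient_pi y.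
Proof. exact: Quotient.pi_add. Qed.

Fact quotient_piZ a x : quotient_pi (a *: x) = quotient_scale a (quotient_pi x).
Proof.
apply/quotient_piP; rewrite -scalerBr rpredZ //.
by apply/quotient_piP; rewrite /quotient_pi reprK.
Qed.

Fact quotient_scaleA a b x :
  quotient_scale a (quotient_scale b x) = quotient_scale (a * b) x.
Proof.
by have [y <-] := quotient_pi_surj x; rewrite -!quotient_piZ scalerA.
Qed.

Fact quotient_scale1 : left_id 1 quotient_scale.
Proof.
by move=> x; have [y <-] := quotient_pi_surj x; rewrite -quotient_piZ scale1r.
Qed.

Fact quotient_scaleDr : right_distributive quotient_scale +%R.
Proof.
move=> a x y; have [u <-] := quotient_pi_surj x.
have [v <-] := quotient_pi_surj y.
by rewrite -quotient_piD -!quotient_piZ scalerDr quotient_piD.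
Qed.

Fact quotient_scaleDl x : {morph quotient_scale^~ x : a b / a + b}.
Proof.
move=> a b; have [y <-] := quotient_pi_surj x.
by rewrite -!quotient_piZ scalerDl quotient_piD.
Qed.

HB.instance Definition _ := GRing.Zmodule_isLmodule.Build R Q
  quotient_scaleA quotient_scale1 quotient_scaleDr quotient_scaleDl.

End Submodule.

Section Hom.
Variables U V : lmodType R.

Definition linear_function : {pred U -> V} := fun f => `[< linear f >].

Fact linear_function_submod_closed : submod_closed linear_function.
Proof.
split=> [|a f g /asboolP lf /asboolP lg]; apply/asboolP => b x y.
  by rewrite scaler0 addr0.
have e h (z : U) : (a *: f + h : U -> V) z = a *: f z + h z by [].
by rewrite !e lf lg !scalerDr !scalerA mulrC addrACA.
Qed.

HB.instance Definition _ := GRing.isSubmodClosed.Build R (U -> V)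
  linear_function (GRing.submod_closed_semi linear_function_submod_closed).

(* Hom_R(U, V), as a submodule of the module of all functions U -> V *)
Definition lmodHom : lmodType R := submodule linear_function.

End Hom.

Section Precomposition.
Variables (U V N : lmodType R) (f : {linear U -> V}).

Fact precomp_subproof (g : lmodHom V N) : val g \o f \in @linear_function U N.
Proof.
case: g => g /= /asboolP lg; apply/asboolP => a x y /=.
by rewrite linearP lg.
Qed.

Definition precomp (g : lmodHom V N) : lmodHom U N :=
  Sub (val g \o f) (precomp_subproof g).

Fact precomp_is_linear : linear precomp.
Proof. by move=> a g h; apply: val_inj; apply/funext. Qed.

HB.instance Definition _ :=
  GRing.isLinear.Build R (lmodHom V N) (lmodHom U N) _ precomp
    precomp_is_linear.

End Precomposition.

(* A complex X indexed homologically by int: [diff i j : X_i -> X_j] is       *)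
(* defined for all i and j to avoid casts between X_(i+1-1) and X_i; only     *)
(* [diff (j + 1) j] is allowed to be nonzero.                                 *)
Record complex := Complex {
  obj :> int -> lmodType R;
  diff : forall i j, {linear obj i -> obj j};
  diff_shape : forall i j, i != j + 1 -> diff i j =1 \0;
  diff_diff : forall i j k, diff j k \o diff i j =1 \0
}.

Section Homology.
Variables (X : complex) (i : int).

Definition cycles : {pred X i} := fun x => diff X i (i - 1) x == 0.

Fact cycles_submod_closed : submod_closed cycles.
Proof.
split=> [|a x y]; rewrite !unfold_in /cycles ?linear0 //.
by rewrite linearP => /eqP-> /eqP->; rewrite scaler0 addr0.
Qed.

HB.instance Definition _ := GRing.isSubmodClosed.Build R (X i) cycles
  (GRing.submod_closed_semi cycles_submod_closed).

Definition boundaries : {pred submodule cycles} :=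
  fun z => `[< exists y : X (i + 1), diff X (i + 1) i y = val z >].

Fact boundaries_submod_closed : submod_closed boundaries.
Proof.
split=> [|a x y /asboolP[u du] /asboolP[v dv]]; apply/asboolP.
  by exists 0; rewrite linear0.
by exists (a *: u + v); rewrite linearP du dv.
Qed.

HB.instance Definition _ := GRing.isSubmodClosed.Build R (submodule cycles)
  boundaries (GRing.submod_closed_semi boundaries_submod_closed).

Definition homology : lmodType R := quotient_module boundaries.

End Homology.

Definition csup (X : complex) : \bar int :=
  esup [set i%:E | i in [set i : int | nonzero_module (X i)]]%classic.

Definition cinf (X : complex) : \bar int :=
  einf [set i%:E | i in [set i : int | nonzero_module (X i)]]%classic.

Definition hinf (X : complex) : \bar int :=
  einf [set i%:E | i in [set i : int | nonzero_module (homology X i)]]%classic.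

Definition bounded_above (X : complex) : Prop := (csup X < +oo)%E.

Definition bounded (X : complex) : Prop := (csup X - cinf X < +oo)%E.

(* The b_i are required not to vanish simultaneously on the range i <= sup I; *)
(* in particular the zero complex is not a quasi-injective resolution.        *)
Definition quasi_injective_resolution M (I : complex) : Prop :=
  [/\ bounded_above I,
      forall i, injective_module (I i) &
      exists b : int -> nat,
        (exists2 i : int, (i%:E <= csup I)%E & b i != 0) /\
        (forall i : int, (i%:E <= csup I)%E ->
           iso_module (homology I i) {ffun 'I_(b i) -> M})].

Definition qid M : \bar int :=
  einf [set v | exists I : complex,
    [/\ quasi_injective_resolution M I, bounded I &
        v = (hinf I - cinf I)%E]]%classic.

Section HomComplex.
Variables (P : complex) (N : lmodType R).

Definition hom_obj (j : int) : lmodType R := lmodHom (P (- j)) N.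

Definition hom_diff (i j : int) : {linear hom_obj i -> hom_obj j} :=
  @precomp _ _ N (diff P (- j) (- i)).

Fact hom_diff_shape i j : i != j + 1 -> hom_diff i j =1 \0.
Proof.
move=> ij g; apply: val_inj; apply/funext => x /=.
rewrite diff_shape; last by apply: contra ij => /eqP ij; apply/eqP; lia.
case: g => g /= /asboolP lg; have := lg (-1) 0 0.
by rewrite !scaleN1r oppr0 add0r addNr.
Qed.

Fact hom_diff_diff i j k : hom_diff j k \o hom_diff i j =1 \0.
Proof.
move=> g; apply: val_inj; apply/funext => x /=.
have /= -> := @diff_diff P (- k) (- j) (- i) x.
case: g => g /= /asboolP lg; have := lg (-1) 0 0.
by rewrite !scaleN1r oppr0 add0r addNr.
Qed.

Definition hom_complex : complex := Complex hom_diff_shape hom_diff_diff.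

End HomComplex.

Record projective_resolution M := ProjectiveResolution {
  pres :> complex;
  pres_projective : forall i, projective_module (pres i);
  pres_ge0 : forall i : int, i < 0 -> ~ nonzero_module (pres i);
  pres_acyclic : forall i : int, 0 < i -> ~ nonzero_module (homology pres i);
  augmentation : {linear pres 0 -> M};
  augmentation_surj : forall x, exists y, augmentation y = x;
  augmentation_exact : forall x,
    augmentation x = 0 <-> exists y, diff pres 1 0 y = x
}.

(* Ext^i_R(M, N), computed from a projective resolution P of M: resolutions   *)
(* exist and, up to isomorphism, the result does not depend on P. The module  *)
(* Hom_R(P_i, N) sits in homological degree -i.                               *)
Definition Ext (i : nat) M (P : projective_resolution M) N : lmodType R :=
  homology (hom_complex P N) (- i%:Z).

Definition grade M : \bar int :=
  einf [set i%:Z%:E | i in [set i : nat |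
    exists P : projective_resolution M, nonzero_module (Ext i P R^o)]]%classic.

End Modules.

Section Rings.
Variable R : comNzRingType.

Definition noetherian : Prop :=
  forall I : submodClosed R^o, finitely_generated (submodule I).

Definition maximal_ideal (m : idealr R) : Prop :=
  forall J : idealr R, {subset m <= J} -> {subset J <= m}.

Definition local_ring (m : idealr R) : Prop :=
  maximal_ideal m /\ forall J : idealr R, maximal_ideal J -> J =i m.

(* Supremum of the lengths n of chains p_0 < ... < p_n of primes in S *)
Definition chain_dim (S : prime_idealr R -> Prop) : \bar int :=
  esup [set n%:Z%:E | n in [set n : nat |
    exists p : nat -> prime_idealr R,
      (forall i, (i <= n)%N -> S (p i)) /\
      (forall i, (i < n)%N ->
         {subset p i <= p i.+1} /\ ~ {subset p i.+1 <= p i})]]%classic.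

Definition krull_dim : \bar int := chain_dim (fun _ => True).

(* The localization M_p is nonzero: some x / 1 is killed by no s outside p *)
Definition support (M : lmodType R) (p : prime_idealr R) : Prop :=
  exists x : M, forall s, s \notin p -> s *: x != 0.

Definition module_dim (M : lmodType R) : \bar int := chain_dim (support M).

(* a_i is a nonzerodivisor on R / (a_0, ..., a_(i-1)), and (a) is proper *)
Definition regular_sequence (a : seq R) : Prop :=
  (forall i r, (i < size a)%N ->
     spans (V := R^o) (take i a) (a`_i * r) -> spans (V := R^o) (take i a) r) /\
  ~ spans (V := R^o) a 1.

(* In the next two definitions m is meant to be the maximal ideal of R. *)
Definition depth (m : idealr R) : \bar int :=
  esup [set n%:Z%:E | n in [set n : nat |
    exists a : seq R,
      [/\ size a = n, {subset a <= m} & regular_sequence a]]]%classic.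

Definition cohen_macaulay (m : idealr R) : Prop := depth m = krull_dim.

End Rings.

(* Main.v *)
Require Import Defs.
From HB Require Import structures.
From mathcomp Require Import all_boot all_order all_algebra.
From mathcomp Require Import ring_quotient constructive_ereal.
From mathcomp Require Import boolp classical_sets.
From mathcomp Require Import ring zify.
Import Order.TTheory GRing.Theory Num.Theory.
Local Open Scope ring_scope.
Set Implicit Arguments.
Unset Strict Implicit.
Unset Printing Implicit Defensive.

(* Let I be a bounded complex of injectives whose homology modules are sums   *)
(* of copies of M, and let E^n(N) be the cohomology of Hom(N, I): a           *)
(* cohomological functor, finitely generated for N finitely generated, with   *)
(* E^n(R) a sum of copies of M. Let a be the largest n with E^n(R) nonzero.   *)
(* For a prime p in Supp M, Ext^i(M, R) = 0 for i < g yields (Rees) an        *)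
(* R-regular sequence x of length g in p, and Nakayama's lemma, applied once  *)
(* for each x_i, puts p in the support of E^(a+g)(R/x). A prime filtration    *)
(* followed by Bass's climbing argument (E^n(R/p) -> E^(n+1)(R/(p+x)) for x   *)
(* in q but not in p) along a chain of primes of length d starting at p gives *)
(* E^n(k) <> 0 for some n >= a+g+d, k being the residue field. On the other   *)
(* hand, if y is a maximal regular sequence of length t then k embeds in R/y, *)
(* so the top nonzero E^r(k) is a quotient of E^r(R/y), which vanishes for    *)
(* r > a+t. Hence t >= g+d: depth R >= dim M + grade M = dim R.               *)
(* Only cyclic modules are needed: Hom(R/J, I) consists of the elements of I  *)
(* killed by J, and every exact sequence used is                              *)
(* 0 -> R/(J : z) -> R/J -> R/(J + z) -> 0.                                   *)

(** * Submodules and Noetherian quotients *)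

(** Since [depth_le_dim] bounds the depth above by dim R, only depth R >= dim M + grade M is at
    stake, and it comes from estimating the degree of nonzero cohomology in two ways. From below,
    [regular_of_ext] turns vanishing Ext into a regular sequence inside the first prime of a chain
    starting in Supp M; [coho_supp_seq], [coho_supp_self] and [coho_supp_chain] then raise the
    degree of a nonzero localized cohomology module by one for each member of the sequence and at
    least one for each step of the chain. From above, [regular_extend] shows that a regular sequence
    in m which is too short for this degree can be prolonged. [regular_of_chain] combines both, and
    [qid_regular] applies it to a bounded quasi-injective resolution. *)

Section Submodules.
Variable R : comNzRingType.
Implicit Types (V : lmodType R) (r : R).

Definition submod V (W : V -> Prop) : Prop :=
  W 0 /\ forall a x y, W x -> W y -> W (a *: x + y).

Lemma submod0 V (W : V -> Prop) : submod W -> W 0.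
Proof. by case. Qed.

Lemma submodZ V (W : V -> Prop) a x : submod W -> W x -> W (a *: x).
Proof. by case=> W0 WD Wx; rewrite -[_ *: _]addr0; apply: WD. Qed.

Lemma submodD V (W : V -> Prop) x y : submod W -> W x -> W y -> W (x + y).
Proof. by case=> W0 WD Wx Wy; rewrite -[x]scale1r; apply: WD. Qed.

Lemma submodB V (W : V -> Prop) x y : submod W -> W x -> W y -> W (x - y).
Proof. by case=> W0 WD Wx Wy; rewrite addrC -scaleN1r; apply: WD. Qed.

Lemma submodI V (W W' : V -> Prop) :
  submod W -> submod W' -> submod (fun x => W x /\ W' x).
Proof.
move=> sW sW'; split=> [|a x y [Wx W'x] [Wy W'y]].
  by split; apply: submod0.
by split; [apply: sW.2|apply: sW'.2].
Qed.

Definition zero_submod V : V -> Prop := fun x => x = 0.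

Lemma submod_zero V : submod (@zero_submod V).
Proof. by split=> // a x y -> ->; rewrite /zero_submod scaler0 addr0. Qed.

Definition gen V (B : V -> Prop) (s : seq V) (x : V) : Prop :=
  forall W, submod W -> (forall y, B y -> W y) -> (forall y, y \in s -> W y) ->
  W x.

Lemma submod_gen V (B : V -> Prop) s : submod (gen B s).
Proof.
split=> [W sW _ _|a x y gx gy W sW BW ssW]; first exact: submod0.
by apply: sW.2; [apply: gx|apply: gy].
Qed.

Lemma gen0 V (B : V -> Prop) s : gen B s 0.
Proof. exact: submod0 (submod_gen _ _). Qed.

Lemma gen_base V (B : V -> Prop) s x : B x -> gen B s x.
Proof. by move=> Bx W sW BW _; apply: BW. Qed.

Lemma gen_mem V (B : V -> Prop) s x : x \in s -> gen B s x.
Proof. by move=> sx W sW _; apply. Qed.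

Lemma gen_trans V (B B' : V -> Prop) s s' :
    (forall y, B y -> gen B' s' y) -> (forall y, y \in s -> gen B' s' y) ->
  forall x, gen B s x -> gen B' s' x.
Proof. by move=> BB ss x; apply => //; apply: submod_gen. Qed.

Lemma gen_nil V (B : V -> Prop) x : submod B -> gen B [::] x -> B x.
Proof. by move=> sB; apply. Qed.

Lemma gen_cons V (B : V -> Prop) v s x :
  gen B (v :: s) x <-> exists r, gen B s (x - r *: v).
Proof.
split=> [gx|[r gx]].
  apply: (gx (fun x => exists r, gen B s (x - r *: v))) => [|y By|y].
  - split=> [|a y z [r1 g1] [r2 g2]].
      by exists 0; rewrite scale0r subr0; exact: gen0.
    exists (a * r1 + r2).
    rewrite scalerDl opprD addrACA -scalerA -scalerBr.
    exact: (proj2 (submod_gen _ _)).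
  - by exists 0; rewrite scale0r subr0; apply: gen_base.
  - rewrite inE => /orP[/eqP->|sy].
      by exists 1; rewrite scale1r subrr; exact: gen0.
    by exists 0; rewrite scale0r subr0; apply: gen_mem.
rewrite -(subrK (r *: v) x); apply: (submodD (submod_gen _ _)).
  apply: gen_trans gx => y; first exact: gen_base.
  by move=> sy; apply: gen_mem; rewrite inE sy orbT.
apply: (submodZ _ (submod_gen _ _)).
by apply: gen_mem; rewrite inE eqxx.
Qed.

Lemma gen_split V (B : V -> Prop) s x : submod B ->
  gen B s x -> exists c, gen (@zero_submod V) s c /\ B (x - c).
Proof.
move=> sB gx.
apply: (gx (fun x => exists c, gen (@zero_submod V) s c /\ B (x - c))) => [|y By|y sy].
- split=> [|a y z [c [gc Bc]] [d [gd Bd]]].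
    exists 0; rewrite subrr; split; last exact: submod0.
    exact: gen0.
  exists (a *: c + d); split; first exact: (proj2 (submod_gen _ _)).
  by rewrite opprD addrACA -scalerBr; apply: sB.2.
- by exists 0; rewrite subr0; split=> //; exact: gen0.
- exists y; rewrite subrr; split; first exact: gen_mem.
  exact: submod0.
Qed.

(* "Z / B is a Noetherian module", for B not necessarily contained in Z *)
Definition noeth V (Z B : V -> Prop) : Prop :=
  forall W, submod W -> (forall x, W x -> Z x) ->
  exists s : seq V, (forall x, x \in s -> W x) /\ forall x, W x -> gen B s x.

Lemma noeth_sub V (Z Z' B : V -> Prop) :
  noeth Z B -> (forall x, Z' x -> Z x) -> noeth Z' B.
Proof. by move=> nZ ZZ W sW WZ; apply: nZ => // x /WZ/ZZ. Qed.

(** Extensions of Noetherian modules are Noetherian: generators of [W] modulo [B'] leave a remainder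
    lying in both [W] and [B'], which the second hypothesis handles. *)
Lemma noeth_ext V (Z B B' : V -> Prop) : submod B' ->
  noeth Z B' -> noeth (fun x => Z x /\ B' x) B -> noeth Z B.
Proof.
move=> sB' nZ nB W sW WZ.
have [s [sW1 Ws]] := nZ W sW WZ.
have [||t [tW Wt]] := nB (fun x => W x /\ B' x); first exact: submodI.
  by move=> x [/WZ].
exists (s ++ t); split=> [x|x Wx].
  by rewrite mem_cat => /orP[/sW1|/tW[]].
have [c [gc Bc]] := gen_split sB' (Ws x Wx).
have Wc : W c by apply: gc => // y ->; apply: submod0.
rewrite -(subrK c x); apply: (submodD (submod_gen _ _)).
  apply: gen_trans (Wt _ (conj (submodB sW Wx Wc) Bc)) => y; first exact: gen_base.
  by move=> ty; apply: gen_mem; rewrite mem_cat ty orbT.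
apply: gen_trans gc => y; first by move=> ->; exact: gen0.
by move=> sy; apply: gen_mem; rewrite mem_cat sy.
Qed.

(** A submodule of V1 x V2, read as a multivalued linear map: maps between homology modules are
    handled on representatives, without forming quotients. *)
Definition linrel V1 V2 (rho : V1 -> V2 -> Prop) : Prop :=
  rho 0 0 /\ forall a x x' y y',
    rho x y -> rho x' y' -> rho (a *: x + x') (a *: y + y').

Lemma linrelZ V1 V2 (rho : V1 -> V2 -> Prop) a x y :
  linrel rho -> rho x y -> rho (a *: x) (a *: y).
Proof. by case=> r0 rD rxy; rewrite -[a *: x]addr0 -[a *: y]addr0; apply: rD. Qed.

(** [rho] induces a map from part of Z1/B1 onto Z2/B2. Generators of the preimage [W1] of [W2] are
    pushed forward along [rho]. *)
Lemma noeth_rel V1 V2 (rho : V1 -> V2 -> Prop) (Z1 B1 : V1 -> Prop)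
    (Z2 B2 : V2 -> Prop) :
    submod Z1 -> submod B1 -> linrel rho -> noeth Z1 B1 ->
    (forall x y, rho x y -> B1 x -> B2 y) ->
    (forall y, Z2 y -> exists x, Z1 x /\ rho x y) ->
  noeth Z2 B2.
Proof.
move=> sZ1 sB1 lrho n1 rB rZ W2 sW2 WZ2.
pose W1 x := Z1 x /\ exists y, W2 y /\ rho x y.
have sW1 : submod W1.
  split=> [|a x x' [Zx [y [Wy rxy]]] [Zx' [y' [Wy' rxy']]]].
    split; first exact: submod0.
    by exists 0; split; [exact: submod0|exact: lrho.1].
  split; first exact: sZ1.2.
  by exists (a *: y + y'); split; [apply: sW2.2|apply: lrho.2].
have [|s1 [sW W1s]] := n1 W1 sW1; first by move=> x [].
have [s2 [s2W s12]] : exists s2 : seq V2, (forall y, y \in s2 -> W2 y) /\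
    forall x, x \in s1 -> exists y, y \in s2 /\ rho x y.
  elim: s1 sW {W1s} => [|x s IH] sW; first by exists [::].
  have [|s2 [s2W s12]] := IH; first by move=> y sy; apply: sW; rewrite inE sy orbT.
  have [_ [y [Wy rxy]]] : W1 x by apply: sW; rewrite inE eqxx.
  exists (y :: s2); split=> z; rewrite inE => /orP[/eqP->|] //.
  - exact: s2W.
  - by exists y; rewrite inE eqxx.
  - by move=> /s12[u [su ru]]; exists u; rewrite inE su orbT.
exists s2; split=> // y W2y.
have [x [Zx rxy]] := rZ y (WZ2 y W2y).
have [|c [gc Bc]] := @gen_split V1 B1 s1 x sB1.
  by apply: W1s; split=> //; exists y.
have [d [rcd gd]] : exists d, rho c d /\ gen (@zero_submod V2) s2 d.
  apply: (gc (fun c => exists d, rho c d /\ gen (@zero_submod V2) s2 d)).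
  - split=> [|a u v [u' [ru gu]] [v' [rv gv]]].
      by exists 0; split; [exact: lrho.1|exact: gen0].
    exists (a *: u' + v'); split; first exact: lrho.2.
    exact: (proj2 (submod_gen _ _)).
  - by move=> u ->; exists 0; split; [exact: lrho.1|exact: gen0].
  - by move=> u /s12[u' [su ru]]; exists u'; split=> //; apply: gen_mem.
rewrite -(subrK d y); apply: (submodD (submod_gen _ _)).
  apply: gen_base; apply: (rB _ _ _ Bc).
  by rewrite addrC -scaleN1r [y - d]addrC -[- d]scaleN1r; apply: lrho.2.
apply: gen_trans gd => z; first by move=> ->; exact: gen0.
exact: gen_mem.
Qed.

Definition submod_pred V (W : V -> Prop) : {pred V} := fun x => `[< W x >].

Lemma submod_predP V (W : V -> Prop) x : (x \in submod_pred W) = `[< W x >].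
Proof. by []. Qed.

Lemma submod_pred_closed V (W : V -> Prop) :
  submod W -> submod_closed (submod_pred W).
Proof.
move=> sW; split=> [|a x y]; rewrite !submod_predP.
  by apply/asboolP; apply: submod0.
by move=> /asboolP Wx /asboolP Wy; apply/asboolP; apply: sW.2.
Qed.

Definition submod_pack V (W : V -> Prop) (sW : submod W) : submodClosed V :=
  HB.pack (submod_pred W) (GRing.isSubmodClosed.Build R V (submod_pred W)
    (GRing.submod_closed_semi (submod_pred_closed sW))).

Lemma submod_packP V (W : V -> Prop) (sW : submod W) x :
  x \in submod_pack sW <-> W x.
Proof. by split => [/asboolP|Wx]; last exact/asboolP. Qed.

Lemma spansP V (s : seq V) x : spans s x <-> gen (@zero_submod V) s x.
Proof.
split=> [[c ->]|].
  move=> W sW _ ssW; elim/big_ind: _ => //; first exact: submod0.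
    by move=> y z; apply: submodD.
  by move=> i _; apply: (submodZ _ sW); apply: ssW; apply: mem_nth.
move=> gx; apply: (gx (spans s)) => [|y ->|y /(nthP 0)[i si <-]].
- split=> [|a y z [c ->] [d ->]].
    by exists (fun=> 0); rewrite big1 // => i _; rewrite scale0r.
  exists (fun i => a * c i + d i); rewrite scaler_sumr -big_split /=.
  by apply: eq_bigr => i _; rewrite scalerDl scalerA.
- by exists (fun=> 0); rewrite big1 // => i _; rewrite scale0r.
- exists (fun j => (j == Ordinal si)%:R).
  rewrite (bigD1 (Ordinal si)) //= eqxx scale1r big1 ?addr0 // => j /negPf->.
  by rewrite scale0r.
Qed.

End Submodules.

(** * Ideals of a Noetherian ring *)

Section Ideals.
Variable R : comNzRingType.
Implicit Types (J P : R -> Prop) (r x z : R).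

Definition ideal J : Prop := submod (V := R^o) J.

Definition igen (J : R -> Prop) (s : seq R) : R -> Prop := gen (V := R^o) J s.

Definition prime_pred P : Prop :=
  [/\ ideal P, ~ P 1 & forall a b, P (a * b) -> P a \/ P b].

(** The ideal J + (x); the next definition is the ideal quotient (J : x). *)
Definition adj J x : R -> Prop := fun r => exists c, J (r - c * x).

Definition colon J x : R -> Prop := fun r => J (r * x).

Lemma ideal0 J : ideal J -> J 0.
Proof. exact: submod0. Qed.

Lemma idealD J a b : ideal J -> J a -> J b -> J (a + b).
Proof. exact: (submodD (V := R^o)). Qed.

Lemma idealB J a b : ideal J -> J a -> J b -> J (a - b).
Proof. exact: (submodB (V := R^o)). Qed.

Lemma ideal_mull J a b : ideal J -> J b -> J (a * b).
Proof. exact: (submodZ (V := R^o)). Qed.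

Lemma ideal_mulr J a b : ideal J -> J a -> J (a * b).
Proof. by rewrite mulrC; apply: ideal_mull. Qed.

Lemma ideal_adj J x : ideal J -> ideal (adj J x).
Proof.
move=> iJ; split=> [|a u v [c Jc] [d Jd]].
  by exists 0; rewrite mul0r subr0; apply: ideal0.
exists (a * c + d); have -> : a *: (u : R^o) + v - (a * c + d) * x =
  a * (u - c * x) + (v - d * x) by rewrite /GRing.scale /=; ring.
by apply: idealD => //; apply: ideal_mull.
Qed.

Lemma adj_sub J x r : J r -> adj J x r.
Proof. by move=> Jr; exists 0; rewrite mul0r subr0. Qed.

Lemma adj_mem J x : ideal J -> adj J x x.
Proof. by move=> iJ; exists 1; rewrite mul1r subrr; apply: ideal0. Qed.

Lemma ideal_colon J x : ideal J -> ideal (colon J x).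
Proof.
move=> iJ; split=> [|a u v]; rewrite /colon; first by rewrite mul0r; apply: ideal0.
have -> : (a *: (u : R^o) + v) * x = a * (u * x) + v * x.
  by rewrite /GRing.scale /=; ring.
by move=> Ju Jv; apply: idealD => //; apply: ideal_mull.
Qed.

Lemma colon_sub J x r : ideal J -> J r -> colon J x r.
Proof. exact: ideal_mulr. Qed.

Lemma igen_cons J x s r : igen J (x :: s) r <-> adj (igen J s) x r.
Proof. exact: (gen_cons (V := R^o)). Qed.

Lemma igen_consE J x s : igen J (x :: s) = adj (igen J s) x.
Proof. by apply: funext => r; apply: propext; apply: igen_cons. Qed.

Lemma igen_nil : igen (@zero_submod R R^o) [::] = @zero_submod R R^o.
Proof.
apply: funext => r; apply: propext; split; last exact: gen_base.
by apply: gen_nil; apply: submod_zero.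
Qed.

Lemma ideal_igen J s : ideal (igen J s).
Proof. exact: submod_gen. Qed.

Lemma ideal_prime P : prime_pred P -> ideal P.
Proof. by case. Qed.

Lemma proper_idealr_pack J : ideal J -> ~ J 1 ->
  exists I : idealr R, forall r, r \in I <-> J r.
Proof.
move=> iJ J1; pose S : {pred R} := fun r => `[< J r >].
have SP r : r \in S <-> J r by split => [/asboolP|Jr]; last exact/asboolP.
have iS : idealr_closed S.
  split=> [||a u v /SP Ju /SP Jv]; first by apply/SP; apply: ideal0.
    by apply/negP => /SP.
  by apply/SP; apply: idealD => //; apply: ideal_mull.
pose I : idealr R := HB.pack S (isIdealr.Build R S iS).
by exists I => r; rewrite -SP.
Qed.

Lemma prime_idealr_pack P : prime_pred P ->
  exists I : prime_idealr R, forall r, r \in I <-> P r.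
Proof.
case=> iJ J1 pP; pose S : {pred R} := fun r => `[< P r >].
have SP r : r \in S <-> P r by split => [/asboolP|Jr]; last exact/asboolP.
have iS : idealr_closed S.
  split=> [||a u v /SP Ju /SP Jv]; first by apply/SP; apply: ideal0.
    by apply/negP => /SP.
  by apply/SP; apply: idealD => //; apply: ideal_mull.
have pS : prime_idealr_closed S.
  move=> u v /SP/pP[] /SP ->; by rewrite ?orbT.
pose I : prime_idealr R := HB.pack S (isIdealr.Build R S iS)
  (isPrimeIdealrClosed.Build R S pS).
by exists I => r; rewrite -SP.
Qed.

Lemma prime_idealr_pred (p : prime_idealr R) : prime_pred (fun r => r \in p).
Proof.
split=> [||a b]; first split=> [|a x y xp yp].
- exact: idealr0.
- by apply: rpredD => //; apply: idealMr.
- by rewrite idealr1.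
- by rewrite prime_idealrM => /orP.
Qed.

Definition spanned (s : seq R) : R -> Prop := igen (@zero_submod R R^o) s.

Definition regular (s : seq R) : Prop := forall i r, (i < size s)%N ->
  spanned (take i s) (s`_i * r) -> spanned (take i s) r.

Lemma ideal_spanned s : ideal (spanned s).
Proof. exact: ideal_igen. Qed.

Lemma spanned_rcons s x : spanned (rcons s x) = adj (spanned s) x.
Proof.
rewrite /spanned -igen_consE; apply: funext => r; apply: propext.
by split; apply: gen_trans => [y By|y ys]; rewrite -/(igen _ _);
  [exact: gen_base|apply: gen_mem; move: ys; rewrite mem_rcons
  |exact: gen_base|apply: gen_mem; rewrite mem_rcons].
Qed.

Lemma regular_rcons s x : regular (rcons s x) <->
  regular s /\ forall r, spanned s (x * r) -> spanned s r.
Proof.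
have takes i : (i <= size s)%N -> take i (rcons s x) = take i s.
  by move=> si; rewrite -cats1 takel_cat.
split=> [rs|[rs rx] i r].
  split=> [i r si|r].
    have := rs i r; rewrite size_rcons takes ?nth_rcons ?si; last exact: ltnW.
    by move=> H; exact: (H (leqW si)).
  have := rs (size s) r; rewrite size_rcons takes // nth_rcons ltnn eqxx take_size.
  by move=> H; exact: (H (ltnSn _)).
rewrite size_rcons ltnS leq_eqVlt => /orP[/eqP->|si].
  by rewrite takes // nth_rcons ltnn eqxx take_size; exact: rx.
by rewrite takes ?nth_rcons ?si; [exact: rs|exact: ltnW].
Qed.

Hypothesis noethR : noetherian R.

Lemma ideal_fg J : ideal J ->
  exists s : seq R, forall r, J r <-> igen (@zero_submod R R^o) s r.
Proof.
move=> iJ; pose I := submod_pack iJ.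
have [s ss] := noethR I.
pose f (x : submodule I) : R := val x.
exists (map f s) => r; split=> [Jr|gr]; last first.
  apply: (gr J) => // [y ->|y /mapP[u _ ->]]; first exact: ideal0.
  by apply: (proj1 (submod_packP iJ _)); apply: valP.
have Ir : r \in I by exact: (proj2 (submod_packP iJ r) Jr).
have /spansP gx := ss (Sub r Ir : submodule I).
apply: (gx (fun u => igen (@zero_submod R R^o) (map f s) (f u))) => [|u ->|u us].
- split=> [|a u v Wu Wv]; first exact: gen0.
  exact: (proj2 (submod_gen _ _)).
- exact: gen0.
- by apply: gen_mem; apply: map_f.
Qed.

Lemma noeth_ring : noeth (V := R^o) (fun=> True) (@zero_submod R R^o).
Proof.
move=> W sW _; have [s Ws] := ideal_fg sW.
by exists s; split=> x; rewrite Ws // => sx; apply: gen_mem.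
Qed.

(** Otherwise choice gives a strictly ascending chain in [F], whose union is finitely generated and
    hence reached at a finite stage. *)
Lemma ideal_max (F : (R -> Prop) -> Prop) :
    (forall J, F J -> ideal J) -> (exists J, F J) ->
  exists J, F J /\
    forall J', F J' -> (forall r, J r -> J' r) -> forall r, J' r -> J r.
Proof.
move=> iF [J0 FJ0]; apply: contrapT => nomax.
have next (K : {J | F J}) : exists K' : {J | F J},
    (forall r, sval K r -> sval K' r) /\ exists r, sval K' r /\ ~ sval K r.
  case: K => J FJ /=; apply: contrapT => noK; apply: nomax; exists J; split=> //.
  move=> J' FJ' JJ' r J'r; apply: contrapT => nJr; apply: noK.
  by exists (exist _ J' FJ'); split=> //; exists r.
have [f fP] := choice next.
pose K n := iter n f (exist _ J0 FJ0).
have KS n r : sval (K n) r -> sval (K n.+1) r by apply: (fP (K n)).1.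
have Kle n k r : sval (K n) r -> sval (K (k + n)%N) r.
  by elim: k => // k IH /IH; apply: KS.
pose U r := exists n, sval (K n) r.
have iK n : ideal (sval (K n)) by exact: (iF _ (svalP (K n))).
have iU : ideal U.
  split=> [|a u v [n Kn] [k Kk]]; first by exists 0%N; apply: (ideal0 (iK _)).
  exists (n + k)%N; apply: idealD; first exact: (iK (n + k)%N).
    by apply: ideal_mull; [exact: (iK (n + k)%N)|rewrite addnC; apply: Kle].
  exact: Kle.
have [s Us] := ideal_fg iU.
have [n sn] : exists n, forall x, x \in s -> sval (K n) x.
  have: forall x, x \in s -> U x by move=> x xs; apply/Us; apply: gen_mem.
  elim: s {Us} => [|x s IH] sU; first by exists 0%N.
  have [|n sn] := IH; first by move=> y ys; apply: sU; rewrite inE ys orbT.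
  have [k Kk] : U x by apply: sU; rewrite inE eqxx.
  exists (n + k)%N => y; rewrite inE => /orP[/eqP->|/sn]; first exact: Kle.
  by rewrite addnC; apply: Kle.
have [r [Kr nKr]] := (fP (K n)).2; apply: nKr.
have: U r by exists n.+1.
by move/Us=> gr; apply: (gr (sval (K n)) (iK n)) => // y ->; exact: ideal0 (iK n).
Qed.

(** An annihilator (J : v) maximal among those above (J : w) is prime: if a b v lies in J but b v
    does not, then (J : b v) contains (J : v), so they agree and a lies in (J : v). *)
Lemma annihilator_above J w : ideal J -> ~ J w ->
  exists w', [/\ ~ J w', forall r, colon J w r -> colon J w' r,
     prime_pred (colon J w') &
     forall v, ~ J v -> (forall r, colon J w' r -> colon J v r) ->
        forall r, colon J v r -> colon J w' r].
Proof.
move=> iJ Jw.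
pose F (K : R -> Prop) := exists v, [/\ K = colon J v, ~ J v &
  forall r, colon J w r -> colon J v r].
have [||K [[v [-> Jv wv]] Kmax]] := @ideal_max F.
- by move=> K [v [-> _ _]]; apply: ideal_colon.
- by exists (colon J w), w.
have vmax u : ~ J u -> (forall r, colon J v r -> colon J u r) ->
    forall r, colon J u r -> colon J v r.
  by move=> Ju vu; apply: Kmax => //; exists u; split=> // r /wv/vu.
exists v; split=> //; split=> [||a b].
- exact: ideal_colon.
- by rewrite /colon mul1r.
rewrite {1}/colon -mulrA => Jabv.
have [Jbv|Jbv] := pselect (J (b * v)); first by right.
left; apply: (vmax (b * v)) => // r; rewrite /colon mulrCA.
exact: ideal_mull.
Qed.

(* Among the finite families of maximal annihilators (J : w) avoided by some  *)
(* element of A, take one whose w's generate, with J, a maximal ideal; prime  *)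
(* avoidance would enlarge it.                                                *)
Lemma zerodivisor_ideal J A : ideal J -> ideal A ->
    (forall z, A z -> exists w, ~ J w /\ J (z * w)) ->
  exists w, [/\ ~ J w, prime_pred (colon J w) & forall z, A z -> J (z * w)].
Proof.
move=> iJ iA Azd; apply: contrapT => noW.
pose good w := [/\ ~ J w, prime_pred (colon J w) &
  forall v, ~ J v -> (forall r, colon J w r -> colon J v r) ->
    forall r, colon J v r -> colon J w r].
pose F K := exists ws, [/\ K = igen J ws, forall w, w \in ws -> good w &
  exists a, A a /\ forall w, w \in ws -> ~ J (a * w)].
have [||K [[ws [-> gws [a [Aa aws]]]] Kmax]] := @ideal_max F.
- by move=> K [ws [-> _ _]]; apply: ideal_igen.
- exists (igen J [::]), [::]; split=> //; exists 0; split=> //; exact: ideal0.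
have [w0 [Jw0 aw0]] := Azd a Aa.
have [w [Jw w0w pw wmax]] := annihilator_above iJ Jw0.
have aw : J (a * w) by apply: w0w.
(* No (J : v) with v in [ws] is contained in (J : w): by maximality they would agree, but [a] lies
   only in the second. The product of the witnesses stays outside the prime (J : w). *)
have [c [cws cw]] : exists c, (forall v, v \in ws -> J (c * v)) /\ ~ J (c * w).
  have : forall v, v \in ws -> exists c, J (c * v) /\ ~ J (c * w).
    move=> v vws; apply: contrapT => noc; apply: (aws v vws).
    have [Jv _ vmax] := gws v vws.
    apply: (vmax w Jw _ a) => // r Jrv; apply: contrapT => Jrw.
    by apply: noc; exists r.
  elim: ws {gws aws Kmax} => [|v ws IH] cP; first by exists 1; split=> //; rewrite mul1r.
  have [|c [cws cw]] := IH; first by move=> u uws; apply: cP; rewrite inE uws orbT.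
  have [|d [dv dw]] := cP v; first by rewrite inE eqxx.
  exists (c * d); split=> [u|].
    rewrite inE => /orP[/eqP->|uws]; rewrite -mulrA; first exact: ideal_mull.
    by rewrite mulrCA; apply: ideal_mull => //; apply: cws.
  by case: pw => _ _ pw /pw[].
have [b [Ab bw]] : exists b, A b /\ ~ J (b * w).
  apply: contrapT => nob; apply: noW; exists w; split=> // z Az.
  by apply: contrapT => zw; apply: nob; exists z.
have nw : ~ igen J ws w.
  move=> gw; apply: cw; apply: (gw (fun x => J (c * x))) => //.
  - split=> [|e x y Jx Jy]; first by rewrite mulr0; apply: ideal0.
    have -> : c * (e *: (x : R^o) + y) = e * (c * x) + c * y.
      by rewrite /GRing.scale /=; ring.
    by apply: idealD => //; apply: ideal_mull.
  - by move=> y Jy; apply: ideal_mull.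
have sub r : igen J ws r -> igen J (w :: ws) r.
  by move=> Jr; apply: (proj2 (igen_cons _ _ _ _)); exact: (adj_sub w Jr).
have ww : igen J (w :: ws) w by apply: gen_mem; rewrite inE eqxx.
apply: nw; apply: (Kmax (igen J (w :: ws)) _ sub w ww).
exists (w :: ws); split=> //.
  by move=> v; rewrite inE => /orP[/eqP->|/gws].
(* Modulo [J] this acts on [ws] as [a], since [c] kills [ws], and on [w] as [b * c], since [a] kills
   [w]. *)
exists (a + b * c); split.
  by apply: idealD => //; rewrite mulrC; apply: ideal_mull.
move=> v; rewrite inE mulrDl => /orP[/eqP->|vws] Jv.
  have : J (b * c * w) by rewrite -[_ * w](addKr (a * w)) addrC; apply: idealB.
  by case: pw => _ _ pw /pw[].
apply: (aws v vws); rewrite -[a * v](addrK (b * c * v)).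
by apply: idealB => //; rewrite -mulrA; apply: ideal_mull => //; apply: cws.
Qed.

(* Nakayama's lemma for Z / B localized at P, in a form providing a nonzero   *)
(* homomorphism Z / B -> (R / P)_P sending m to r / s.                        *)
Lemma nakayama (V : lmodType R) (Z B : V -> Prop) P : submod B ->
    noeth Z B -> submod Z -> prime_pred P ->
    (exists y, Z y /\ forall s, ~ P s -> ~ B (s *: y)) ->
  exists (W : V -> Prop) (v : V) (s : R),
    [/\ submod W, forall x : V, B x -> W x, Z v, ~ P s &
    (forall m, Z m -> exists r, W (s *: m - r *: v)) /\
    (forall r, W (r *: v) -> P r)].
Proof.
move=> sB nZ sZ [_ P1 pP] [y [Zy By]].
have [l [lZ Zl]] := nZ Z sZ (fun _ Zx => Zx).
have {Zl} : exists s, ~ P s /\ forall m, Z m -> gen B l (s *: m).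
  by exists 1; split=> // m Zm; rewrite scale1r; apply: Zl.
elim: l lZ => [|v l IH] lZ [s [Ps Zs]].
  by case: (By s Ps); apply: gen_nil => //; apply: Zs.
have lZ' (x : V) : x \in l -> Z x by move=> xl; apply: lZ; rewrite inE xl orbT.
(* If a multiple of [v] by an element outside [P] is spanned by [l], then [v] is redundant at [P]
   and is dropped; otherwise [W] is the span of [B] and [l]. *)
have [[r [Pr rv]]|nor] := pselect (exists r, ~ P r /\ gen B l (r *: v)).
  apply: IH => //; exists (r * s); split=> [/pP[]|m Zm] //.
  have /gen_cons[c gc] := Zs m Zm.
  rewrite -scalerA -[_ *: m](subrK (c *: v)) scalerDr.
  apply: (submodD (submod_gen _ _)); first exact: (submodZ _ (submod_gen _ _)).
  by rewrite scalerA mulrC -scalerA; apply: (submodZ _ (submod_gen _ _)).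
exists (gen B l), v, s; split=> //.
- exact: submod_gen.
- by move=> x; apply: gen_base.
- by apply: lZ; rewrite inE eqxx.
split=> [m Zm|r rv]; first exact: (proj1 (gen_cons _ _ _ _) (Zs m Zm)).
by apply: contrapT => Pr; apply: nor; exists r.
Qed.

Lemma local_max (m : idealr R) J : local_ring m -> ideal J -> ~ J 1 ->
  forall r, J r -> r \in m.
Proof.
move=> [_ lm] iJ J1 r Jr.
pose F K := [/\ ideal K, ~ K 1 & forall r, J r -> K r].
have [||K [[iK K1 JK] Kmax]] := @ideal_max F; first by move=> K [].
  by exists J.
have [I IP] := proper_idealr_pack iK K1.
rewrite -(lm I) ?IP; first exact: JK.
move=> J' IJ' x J'x; apply/IP/(Kmax (fun x => x \in J')) => //.
  split=> [||y /JK/IP/IJ'//]; last by rewrite idealr1.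
  split=> [|a u v uJ vJ]; first exact: idealr0.
  by apply: rpredD => //; apply: idealMr.
by move=> y /IP/IJ'.
Qed.

Lemma local_prime (m : idealr R) : local_ring m -> prime_pred (fun r => r \in m).
Proof.
move=> lm; have im : ideal (fun r => r \in m).
  split=> [|a u v um vm]; first exact: idealr0.
  by apply: rpredD => //; apply: idealMr.
split=> //; first by rewrite idealr1.
move=> a b abm; have [am|am] := boolP (a \in m); [by left|right].
have [c mc] : adj (fun r => r \in m) a 1.
  apply: contrapT => n1; move/negP: am; apply.
  by apply: (local_max lm (ideal_adj a im) n1); apply: adj_mem.
have -> : b = (1 - c * a) * b + c * (a * b) by ring.
by apply: (idealD im); [apply: (ideal_mulr _ im)|apply: (ideal_mull _ im)].
Qed.

End Ideals.

(** * Cohomology of R/J with values in a complex of injectives *)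

Section CyclicInjectivity.
Variable R : comNzRingType.

Lemma linear_pack (U V : lmodType R) (f : U -> V) : linear f ->
  exists g : {linear U -> V}, g =1 f.
Proof.
move=> lf; pose g : {linear U -> V} := HB.pack f (GRing.isLinear.Build R U V _ f lf).
by exists g.
Qed.

Lemma quotient_lift (V N : lmodType R) (W : submodClosed V) (phi : {linear V -> N}) :
    (forall x, x \in W -> phi x = 0) ->
  exists g : {linear quotient_module W -> N}, forall x, g (quotient_pi W x) = phi x.
Proof.
move=> phi0; have [r rK] := choice (@quotient_pi_surj R V W).
have phiE x y : quotient_pi W x = quotient_pi W y -> phi x = phi y.
  by move=> /quotient_piP/phi0/eqP; rewrite linearB subr_eq0 => /eqP.
have [|g gE] := @linear_pack (quotient_module W) N (phi \o r).
  move=> a u v /=; rewrite -linearP; apply: phiE; rewrite quotient_piD quotient_piZ.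
  by rewrite !rK.
by exists g => x; rewrite gE; apply/phiE/rK.
Qed.

Lemma quotient_pi_linear (V : lmodType R) (W : submodClosed V) :
  linear (quotient_pi W).
Proof. by move=> a x y; rewrite quotient_piD quotient_piZ. Qed.

(* The map R/(J : z) -> R/J given by multiplication by z is injective. *)
Lemma injective_module_colon (N : lmodType R) (J : R -> Prop) z (y : N) :
    injective_module N -> ideal J -> (forall r, J (r * z) -> r *: y = 0) ->
  exists w : N, (forall r, J r -> r *: w = 0) /\ z *: w = y.
Proof.
move=> iN iJ Jy.
pose Wc := submod_pack (ideal_colon z iJ); pose WJ := submod_pack iJ.
pose piJ := quotient_pi WJ.
have piJP (x x' : R) : piJ x = piJ x' <-> J (x - x').
  split=> [e|Jx]; first by apply/(submod_packP iJ); apply/quotient_piP.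
  by apply/(quotient_piP WJ); apply/(submod_packP iJ).
have [phi phiE] : exists f : {linear R^o -> quotient_module WJ},
    forall x : R, f x = piJ (x * z).
  apply: linear_pack => a u v.
  rewrite -quotient_pi_linear; congr quotient_pi.
  by rewrite /GRing.scale /=; ring.
have [f fE] : exists f : {linear quotient_module Wc -> quotient_module WJ},
    forall x : R^o, f (quotient_pi Wc x) = phi x.
  apply: quotient_lift => x /(submod_packP (ideal_colon z iJ)) Jx.
  rewrite phiE -[0](linear0 phi) phiE; apply/piJP.
  by rewrite mul0r subr0.
have [psi psiE] : exists f : {linear R^o -> N}, forall x : R, f x = x *: y.
  by apply: linear_pack => a u v; rewrite scalerA -scalerDl.
have [g gE] : exists g : {linear quotient_module Wc -> N},
    forall x : R^o, g (quotient_pi Wc x) = psi x.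
  apply: quotient_lift => x /(submod_packP (ideal_colon z iJ)) Jx.
  by rewrite psiE Jy.
have [pi piE] := linear_pack (@quotient_pi_linear R^o WJ).
have f_inj : injective f.
  move=> u v; have [x <-] := quotient_pi_surj u; have [x' <-] := quotient_pi_surj v.
  rewrite !fE !phiE => /piJP; rewrite -mulrBl => Jx.
  by apply/quotient_piP; apply/(submod_packP (ideal_colon z iJ)).
have [h hf] := iN _ _ f g f_inj.
have hE (x : R) : h (piJ x) = x *: h (piJ 1).
  rewrite -linearZ /piJ -!piE -linearZ; congr (h (pi _)).
  by rewrite /GRing.scale /= mulr1.
exists (h (piJ 1)); split=> [r Jr|].
  rewrite -hE -[RHS](linear0 h); congr (h _).
  by rewrite -(linear0 pi) piE; apply/piJP; rewrite subr0.
rewrite -hE -[z in piJ z]mul1r -phiE -fE.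
by have /= -> := hf (quotient_pi Wc 1); rewrite gE psiE scale1r.
Qed.

End CyclicInjectivity.

(** * The long exact cohomology sequence for cyclic modules *)

Section InjectiveComplex.
Variable R : comNzRingType.
Hypothesis noethR : noetherian R.
Variables (I : nat -> lmodType R) (d : forall n, {linear I n -> I n.+1}).
Hypothesis dd : forall n x, d n.+1 (d n x) = 0.
Hypothesis injI : forall n, injective_module (I n).
Hypothesis I0 : forall x : I 0, x = 0.
Implicit Types (J P q : R -> Prop).

(* With Hom(R/J, N) identified with the elements of N killed by J, coch, coc  *)
(* and cob describe the cochains, cocycles and coboundaries of Hom(R/J, I);   *)
(* the index of coc and cob is shifted, so that no coboundary is needed in    *)
(* degree 0.                                                                  *)
Definition coch J n (h : I n) : Prop := forall r, J r -> r *: h = 0.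
Definition coc J n (y : I n.+1) : Prop := coch J y /\ d n.+1 y = 0.
Definition cob J n (y : I n.+1) : Prop := exists h : I n, coch J h /\ y = d n h.

(** Vanishing of E^n(R/J), and next its nonvanishing after localization at q, witnessed by a class
    y/1. *)
Definition coho_zero J n : Prop := forall y : I n.+1, coc J y -> cob J y.
Definition coho_supp J n q : Prop :=
  exists y : I n.+1, coc J y /\ forall s, ~ q s -> ~ cob J (s *: y).

Lemma submod_coch J n : submod (@coch J n).
Proof.
split=> [r _|a x y Jx Jy r Jr]; first by rewrite scaler0.
by rewrite scalerDr scalerA mulrC -scalerA Jx // Jy // scaler0 addr0.
Qed.

Lemma submod_coc J n : submod (@coc J n).
Proof.
split=> [|a x y [Jx dx] [Jy dy]].
  by split; [exact: submod0 (submod_coch _ _)|rewrite linear0].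
split; first exact: (submod_coch _ _).2.
by rewrite linearP dx dy scaler0 addr0.
Qed.

Lemma submod_cob J n : submod (@cob J n).
Proof.
split=> [|a x y [h [Jh ->]] [k [Jk ->]]].
  by exists 0; split; [exact: submod0 (submod_coch _ _)|rewrite linear0].
by exists (a *: h + k); split; [exact: (submod_coch _ _).2|rewrite linearP].
Qed.

Lemma coch_sub J J' n (h : I n) : (forall r, J r -> J' r) -> coch J' h -> coch J h.
Proof. by move=> JJ J'h r /JJ; apply: J'h. Qed.

Lemma coc_sub J J' n (h : I n.+1) : (forall r, J r -> J' r) -> coc J' h -> coc J h.
Proof. by move=> JJ [/(coch_sub JJ)]. Qed.

Lemma cob_sub J J' n (h : I n.+1) : (forall r, J r -> J' r) -> cob J' h -> cob J h.
Proof. by move=> JJ [k [/(coch_sub JJ) Jk ->]]; exists k. Qed.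

Lemma coch_d J n (h : I n) : coch J h -> coch J (d n h).
Proof. by move=> Jh r Jr; rewrite -linearZ Jh // linear0. Qed.

Lemma coch_colon J n z (h : I n) : coch J h -> coch (colon J z) (z *: h).
Proof. by move=> Jh r Jr; rewrite scalerA Jh. Qed.

Lemma coch_adj J n z (h : I n) : coch J h -> z *: h = 0 -> coch (adj J z) h.
Proof.
move=> Jh zh r [c Jc]; rewrite -(subrK (c * z) r) scalerDl Jh // add0r.
by rewrite -scalerA zh scaler0.
Qed.

Lemma coch_adj_kill J n z (h : I n) : ideal J -> coch (adj J z) h -> z *: h = 0.
Proof. by move=> iJ; apply; apply: adj_mem. Qed.

Lemma coch_lift J n z (y : I n) : ideal J -> coch (colon J z) y ->
  exists w, coch J w /\ z *: w = y.
Proof. by move=> iJ Jy; apply: injective_module_colon. Qed.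

(* In the long exact sequence of 0 -> R/(J : z) -> R/J -> R/(J + z) -> 0, the *)
(* connecting map E^n(R/(J : z)) -> E^(n+1)(R/(J + z)) sends the class of z w *)
(* to that of d w, for w a cochain of R/J.                                    *)
Lemma coho_connect J n z (w : I n.+1) : ideal J -> coch J w -> d n.+1 (z *: w) = 0 ->
  coc (adj J z) (d n.+1 w).
Proof.
move=> iJ Jw zw; split; last exact: dd.
by apply: coch_adj; [exact: coch_d|rewrite -linearZ].
Qed.

(** Exactness at E^n(R/(J : z)), up to the factor [s]: the lift to E^n(R/J) is [s *: w] corrected by
    the cochain that bounds its differential. *)
Lemma coho_connect_exact J n z s (w : I n.+1) : ideal J -> coch J w ->
    d n.+1 (z *: w) = 0 -> cob (adj J z) (s *: d n.+1 w) ->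
  exists u, coc J u /\ z *: u = s *: (z *: w).
Proof.
move=> iJ Jw zw [h [Jh dh]]; exists (s *: w - h); split.
  split; last by rewrite linearB linearZ /= dh subrr.
  apply: (submodB (submod_coch _ _)); first exact: (submodZ _ (submod_coch _ _)).
  by apply: coch_sub Jh => r; apply: adj_sub.
by rewrite scalerBr (coch_adj_kill iJ Jh) subr0 !scalerA mulrC.
Qed.

(** Exactness at E^n(R/J): injectivity lifts the cochain bounding z y along multiplication by z, and
    subtracting the differential of the lift leaves a cocycle killed by z. *)
Lemma coho_mul_exact J n z (y : I n.+1) : ideal J -> coc J y ->
    cob (colon J z) (z *: y) ->
  exists u, coc (adj J z) u /\ cob J (y - u).
Proof.
move=> iJ [Jy dy] [h [Jh dh]].
have [l [Jl zl]] := coch_lift iJ Jh.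
exists (y - d n l); split; last by exists l; split=> //; rewrite opprB addrC subrK.
split; last by rewrite linearB /= dy dd subrr.
apply: coch_adj; first exact: (submodB (submod_coch _ _) Jy (coch_d Jl)).
by rewrite scalerBr dh -zl linearZ subrr.
Qed.

(** The connecting map is well defined: subtracting a coboundary from [h] makes it killed by z and
    leaves its differential unchanged. *)
Lemma coho_incl_exact J n z (h : I n.+1) : ideal J -> coch J h ->
    cob (colon J z) (z *: h) -> cob (adj J z) (d n.+1 h).
Proof.
move=> iJ Jh [k [Jk dk]]; have [l [Jl zl]] := coch_lift iJ Jk.
exists (h - d n l); split; last by rewrite linearB /= dd subr0.
apply: coch_adj; first exact: (submodB (submod_coch _ _) Jh (coch_d Jl)).
by rewrite scalerBr dk -zl linearZ subrr.
Qed.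

Lemma regular_colon J x : ideal J -> (forall r, J (x * r) -> J r) -> colon J x = J.
Proof.
move=> iJ Jx; apply: funext => r; apply: propext; rewrite /colon.
by split; [rewrite mulrC; apply: Jx|apply: ideal_mulr].
Qed.

Lemma regular_prime P x r : prime_pred P -> ~ P x -> P (x * r) -> P r.
Proof. by move=> [_ _ pP] Px /pP[]. Qed.

(** * Finiteness and supports of the cohomology *)

Hypothesis noethI : forall n,
  noeth (@coc (@zero_submod R R^o) n) (@cob (@zero_submod R R^o) n).

(** E^(k+1)(R/(J + x)) is built from a submodule of E^(k+1)(R/J) and the image of E^k(R/(J : x)).
    Induction is on the degree first, as (J : x) may need more generators than J; in degree 0 the
    second piece vanishes because I 0 does. *)
Lemma coho_noeth n J : ideal J -> noeth (@coc J n) (@cob J n).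
Proof.
suff H k s : noeth (@coc (igen (@zero_submod R R^o) s) k)
    (@cob (igen (@zero_submod R R^o) s) k).
  move=> iJ; have [s Js] := ideal_fg noethR iJ.
  suff -> : J = igen (@zero_submod R R^o) s by apply: H.
  by apply: funext => r; apply: propext.
elim: k s {n J} => [|k IHk] s; elim: s => [|x s IHs].
- rewrite igen_nil; exact: noethI.
- have iJ := ideal_igen (@zero_submod R R^o) s.
  rewrite igen_consE.
  set J := igen _ s in iJ IHs *.
  apply: (@noeth_ext _ _ _ _ (@cob J 0)); first exact: submod_cob.
    by apply: noeth_sub IHs _ => y; apply: coc_sub => r; apply: adj_sub.
  move=> W sW WZ; exists [::]; split=> // y /WZ[_ [h [_ ->]]].
  by rewrite (I0 h) linear0; apply: gen0.
- rewrite igen_nil; exact: noethI.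
have iJ := ideal_igen (@zero_submod R R^o) s.
rewrite igen_consE.
set J := igen _ s in iJ IHs *.
apply: (@noeth_ext _ _ _ _ (@cob J k.+1)); first exact: submod_cob.
  by apply: noeth_sub IHs _ => y; apply: coc_sub => r; apply: adj_sub.
(* The connecting map as a linear relation, from x h to d h. *)
pose rho (u : I k.+1) (y : I k.+2) :=
  exists h, [/\ coch J h, y = d k.+1 h & u = x *: h].
have nc : noeth (@coc (colon J x) k) (@cob (colon J x) k).
  have [t Jt] := ideal_fg noethR (ideal_colon x iJ).
  suff -> : colon J x = igen (@zero_submod R R^o) t by apply: IHk.
  by apply: funext => r; apply: propext.
apply: (@noeth_rel _ _ _ rho (@coc (colon J x) k) (@cob (colon J x) k)) nc _ _.
- exact: submod_coc.
- exact: submod_cob.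
- split=> [|a u u' y y' [h [Jh -> ->]] [h' [Jh' -> ->]]].
    exists 0; split; [exact: submod0 (submod_coch _ _)|by rewrite linear0|].
    by rewrite scaler0.
  exists (a *: h + h'); split; [exact: (submod_coch _ _).2|by rewrite linearP|].
  by rewrite scalerDr !scalerA mulrC.
- move=> u y [h [Jh -> ->]]; exact: coho_incl_exact.
move=> y [[Jy dy] [h [Jh yh]]]; exists (x *: h); split; last by exists h.
split; first exact: coch_colon.
by rewrite linearZ /= -yh (coch_adj_kill iJ Jy).
Qed.

Lemma coho_supp_sub J n q r : coho_supp J n q -> J r -> q r.
Proof.
move=> [y [[Jy _] qy]] Jr; apply: contrapT => /qy; apply.
by rewrite Jy //; apply: (submod0 (submod_cob _ _)).
Qed.

Lemma coho_supp_mono J n q q' : (forall r, q r -> q' r) ->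
  coho_supp J n q -> coho_supp J n q'.
Proof. by move=> qq' [y [Zy qy]]; exists y; split=> // s q's; apply: qy => /qq'. Qed.

Lemma coho_not_supp J n q y : ~ coho_supp J n q -> coc J y ->
  exists s, ~ q s /\ cob (n := n) J (s *: y).
Proof.
move=> nJ Zy; apply: contrapT => nos; apply: nJ; exists y; split=> // s qs Bs.
by apply: nos; exists s.
Qed.

(** Since x is a nonzerodivisor on R/J, the cokernel of x on E^n(R/J) embeds in E^(n+1)(R/(J + x)).
    If the latter vanished at q, then x in q would act surjectively on a nonzero finitely generated
    module over the local ring at q, against Nakayama's lemma. *)
Lemma coho_supp_climb J n q x : ideal J -> prime_pred q ->
    (forall r, J (x * r) -> J r) -> q x ->
  coho_supp J n q -> coho_supp (adj J x) n.+1 q.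
Proof.
move=> iJ pq Jx qx sJ; apply: contrapT => nJ.
have [W [v [s [sW BW [Jv dv] qs [Wr Wq]]]]] :=
  nakayama (submod_cob J n) (coho_noeth iJ) (submod_coc J n) pq sJ.
have [|w [Jw xw]] := @coch_lift J _ x v iJ; first by rewrite regular_colon.
have dxw : d n.+1 (x *: w) = 0 by rewrite xw.
have [t [qt Bt]] := coho_not_supp nJ (coho_connect iJ Jw dxw).
have [u [Zu xu]] := coho_connect_exact iJ Jw dxw Bt.
have [r Wsr] := Wr u Zu.
have [iq _ pq'] := pq.
(* Modulo [W], s t v = x s u = x r v, so s t - x r lies in q, and then so does s t. *)
suff /pq'[] : q (s * t) by [].
rewrite -(subrK (x * r) (s * t)); apply: (idealD iq); last exact: ideal_mulr.
apply: Wq; have -> : (s * t - x * r) *: v = x *: (s *: u - r *: v).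
  by rewrite scalerBl scalerBr -!scalerA -xw -xu [x *: (s *: u)]scalerA mulrC -scalerA.
exact: (submodZ _ sW).
Qed.

(** An ideal K above J, maximal with q in the support of E^n(R/K), is prime: if a b lies in K but a
    and b do not, then K + (a) and (K : a) are strictly larger, so both ends of E^n(R/(K + a)) ->
    E^n(R/K) -> E^n(R/(K : a)) vanish at q. *)
Lemma coho_supp_prime J n q : ideal J -> prime_pred q -> coho_supp J n q ->
  exists P, [/\ prime_pred P, forall r, J r -> P r & coho_supp P n q].
Proof.
move=> iJ pq sJ.
pose F K := [/\ ideal K, forall r, J r -> K r & coho_supp K n q].
have [||K [[iK JK sK] Kmax]] := @ideal_max R noethR F; first by move=> K [].
  by exists J.
have [iq q1 pq'] := pq.
exists K; split=> //; split=> // [K1|a b Kab]; first exact: q1 (coho_supp_sub sK K1).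
apply: contrapT => /not_orP[Ka Kb].
have Fmax K' x : ideal K' -> (forall r, K r -> K' r) -> K' x -> ~ K x ->
    ~ coho_supp K' n q.
  move=> iK' KK' K'x Kx sK'; apply/Kx/(Kmax K') => //.
  by split=> // r /JK/KK'.
have nadj : ~ coho_supp (adj K a) n q.
  by apply: (Fmax _ a) => //; [exact: ideal_adj|move=> r; apply: adj_sub|exact: adj_mem].
have ncol : ~ coho_supp (colon K a) n q.
  apply: (Fmax _ b) => //; [exact: ideal_colon|move=> r; exact: colon_sub|].
  by rewrite /colon mulrC.
have [y [[Ky dy] qy]] := sK.
have [|s [qs Bs]] := coho_not_supp ncol (y := a *: y).
  by split; [exact: coch_colon|rewrite linearZ /= dy scaler0].
have [||u [Zu Bu]] := @coho_mul_exact K n a (s *: y) iK.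
- exact: (submodZ _ (submod_coc _ _)).
- by rewrite scalerA mulrC -scalerA.
have [t [qt Bt]] := coho_not_supp nadj Zu.
apply: (qy (t * s)) => [/pq'[]//|].
rewrite -scalerA -[s *: y](subrK u) scalerDr; apply: (submodD (submod_cob _ _)).
  exact: (submodZ _ (submod_cob _ _)).
by apply: cob_sub Bt => r; apply: adj_sub.
Qed.

(** Among the primes reached in degrees at least n, a maximal one must be q: for x in q outside it,
    climbing by x and applying [coho_supp_prime] gives a strictly larger one. *)
Lemma coho_supp_self J n q : ideal J -> prime_pred q -> coho_supp J n q ->
  exists n', (n <= n')%N /\ coho_supp q n' q.
Proof.
move=> iJ pq sJ.
pose F K := prime_pred K /\ exists n', (n <= n')%N /\ coho_supp K n' q.
have [||K [[pK [n' [nn' sK]]] Kmax]] := @ideal_max R noethR F.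
- by move=> K [/ideal_prime].
- by have [P [pP _ sP]] := coho_supp_prime iJ pq sJ; exists P; split=> //; exists n.
exists n'; split=> //; suff e : q = K by rewrite {1}e.
apply: funext => x; apply: propext; split; last exact: coho_supp_sub sK.
move=> qx; apply: contrapT => Kx; have iK := ideal_prime pK.
have := coho_supp_climb iK pq (fun r => @regular_prime K x r pK Kx) qx sK.
move=> /(coho_supp_prime (ideal_adj x iK) pq)[P [pP KP sP]].
apply: Kx; apply: (Kmax P) => //.
- by split=> //; exists n'.+1; split=> //; apply: leqW.
- by move=> r Kr; apply: KP; apply: adj_sub.
- by apply: KP; apply: adj_mem.
Qed.

Lemma coho_supp_step P n q x : prime_pred P -> prime_pred q ->
    (forall r, P r -> q r) -> q x -> ~ P x -> coho_supp P n P ->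
  exists n', (n < n')%N /\ coho_supp q n' q.
Proof.
move=> pP pq Pq qx Px sP; have iP := ideal_prime pP.
have := coho_supp_climb iP pq (fun r => @regular_prime P x r pP Px) qx (coho_supp_mono Pq sP).
exact: (coho_supp_self (ideal_adj x iP) pq).
Qed.

Lemma coho_supp_chain (p : nat -> R -> Prop) k n :
    (forall i, (i <= k)%N -> prime_pred (p i)) ->
    (forall i, (i < k)%N -> (forall r, p i r -> p i.+1 r) /\
       exists x, p i.+1 x /\ ~ p i x) ->
    coho_supp (p 0%N) n (p 0%N) ->
  exists n', (n + k <= n')%N /\ coho_supp (p k) n' (p k).
Proof.
elim: k => [|k IH] pp pS s0; first by exists n; rewrite addn0.
have [i ik|i ik|//|n' [nn' sk]] := IH; first by apply: pp; apply: leqW.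
  by apply: pS; apply: leqW.
have [pk [x [px npx]]] := pS k (ltnSn k).
have [n'' [nn'' s'']] := coho_supp_step (pp k (leqnSn k)) (pp k.+1 (leqnn _)) pk px npx sk.
by exists n''; split=> //; rewrite addnS; apply: leq_ltn_trans nn' nn''.
Qed.

Lemma coho_zero_adj J n x : ideal J -> (forall r, J (x * r) -> J r) ->
  coho_zero J n -> coho_zero J n.+1 -> coho_zero (adj J x) n.+1.
Proof.
move=> iJ Jx z0 z1 y [Jy dy].
have [|h [Jh yh]] := z1 y.
  by split=> //; apply: coch_sub Jy => r; apply: adj_sub.
rewrite yh; apply: coho_incl_exact => //; rewrite regular_colon //.
apply: z0; split; first exact: (submodZ _ (submod_coch _ _)).
by rewrite linearZ /= -yh (coch_adj_kill iJ Jy).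
Qed.

(** Exactness at q of E^n(R/J) -> E^n(R/(J : w)) -> E^(n+1)(R/(J + w)). *)
Lemma coho_supp_nonzero J n w q : ideal J -> coho_supp (colon J w) n q ->
  ~ coho_supp (adj J w) n.+1 q -> ~ coho_zero J n.
Proof.
move=> iJ [y [[Jy dy] qy]] nadj zJ.
have [u [Ju wu]] := coch_lift iJ Jy.
have dwu : d n.+1 (w *: u) = 0 by rewrite wu.
have [s [qs Bs]] := coho_not_supp nadj (coho_connect iJ Ju dwu).
have [v [Zv wv]] := coho_connect_exact iJ Ju dwu Bs.
have [k [Jk vk]] := zJ v Zv.
apply: (qy s qs); exists (w *: k); split; first exact: coch_colon.
by rewrite linearZ /= -vk wv wu.
Qed.

(** * Prolonging regular sequences from cohomology in high degree *)

Variables a b : nat.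
Hypothesis coho_high : forall n, (a < n)%N -> coho_zero (@zero_submod R R^o) n.
Hypothesis I_high : forall n (x : I n), (b < n)%N -> x = 0.

Lemma coho_supp_seq s q : prime_pred q -> regular s -> (forall x, x \in s -> q x) ->
  coho_supp (@zero_submod R R^o) a q -> coho_supp (spanned s) (a + size s) q.
Proof.
move=> pq; elim/last_ind: s => [|s x IH] rs qs s0.
  by rewrite addn0 /spanned igen_nil.
have /regular_rcons[rs' rx] := rs.
rewrite size_rcons addnS spanned_rcons.
apply: coho_supp_climb => //; first exact: ideal_spanned.
  by apply: qs; rewrite mem_rcons inE eqxx.
by apply: IH => // y ys; apply: qs; rewrite mem_rcons inE ys orbT.
Qed.

Lemma coho_zero_seq s n : regular s -> (a + size s < n)%N -> coho_zero (spanned s) n.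
Proof.
elim/last_ind: s n => [|s x IH] n.
  by rewrite addn0 /spanned igen_nil => _; apply: coho_high.
move=> /regular_rcons[rs rx]; rewrite size_rcons addnS spanned_rcons.
case: n => // n an; apply: coho_zero_adj => //; first exact: ideal_spanned.
  exact: IH.
by apply: IH => //; apply: leqW.
Qed.

(* If s is a maximal regular sequence, the residue field embeds in R/(s), so  *)
(* its top nonzero cohomology is hit by that of R/(s).                        *)
Lemma regular_extend (m : idealr R) s J n : local_ring m -> regular s ->
    (forall x, x \in s -> x \in m) -> ideal J ->
    coho_supp J n (fun r => r \in m) -> (a + size s < n)%N ->
  exists x, x \in m /\ regular (rcons s x).
Proof.
move=> lm rs sm iJ sJ an; apply: contrapT => nox.
have pm := local_prime noethR lm; have is_ := ideal_spanned s.
have [|w [sw _ mw]] := zerodivisor_ideal noethR is_ (ideal_prime pm).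
  move=> z mz; apply: contrapT => zs; apply: nox; exists z; split=> //.
  apply/regular_rcons; split=> // r szr; apply: contrapT => sr.
  by apply: zs; exists r.
have colm : colon (spanned s) w = fun r => r \in m.
  apply: funext => r; apply: propext; split; last exact: mw.
  by apply: (local_max noethR lm); [exact: ideal_colon|rewrite /colon mul1r].
(* The degrees where m supports some E^n(R/K), for arbitrary K. The top one, [k], is attained at
   R/m, and its maximality makes E^(k+1)(R/((s) + w)) vanish at m. *)
pose Q n := `[< exists K, ideal K /\ coho_supp K n (fun r => r \in m) >].
have exQ : exists n, Q n by exists n; apply/asboolP; exists J.
have bQ k : Q k -> (k <= b)%N.
  move=> /asboolP[K [_ [y [_ my]]]]; rewrite leqNgt; apply/negP => bk.
  apply: (my 1); first by rewrite idealr1.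
  by rewrite (I_high y (leqW bk)) scaler0; apply: (submod0 (submod_cob _ _)).
have [k /asboolP[K [iK sK]] kmax] := ex_maxnP exQ bQ.
have [k' [kk' sm']] := coho_supp_self iK pm sK.
have ek : k' = k.
  apply/eqP; rewrite eqn_leq kk' andbT; apply: kmax; apply/asboolP.
  by exists (fun r => r \in m); split=> //; apply: ideal_prime.
have nk : (n <= k)%N by apply: kmax; apply/asboolP; exists J.
apply: (@coho_supp_nonzero (spanned s) k w (fun r => r \in m)) => //.
- by rewrite colm -ek.
- move=> sadj; have: Q k.+1.
    by apply/asboolP; exists (adj (spanned s) w); split=> //; apply: ideal_adj.
  by move/kmax; rewrite ltnn.
by apply: coho_zero_seq => //; apply: leq_trans nk.
Qed.

(** The sequence [s] and the chain put m in a support in degree at least a + size s + k. The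
    sequence [t] is grown from the empty one, not from [s]: [regular_extend] applies while it has
    fewer than size s + k terms. *)
Lemma regular_of_chain (m : idealr R) (p : nat -> R -> Prop) k s : local_ring m ->
    (forall i, (i <= k)%N -> prime_pred (p i)) ->
    (forall i, (i < k)%N -> (forall r, p i r -> p i.+1 r) /\
       exists x, p i.+1 x /\ ~ p i x) ->
    regular s -> (forall x, x \in s -> p 0%N x) ->
    coho_supp (@zero_submod R R^o) a (p 0%N) ->
  exists t, [/\ size t = (size s + k)%N, regular t & forall x, x \in t -> x \in m].
Proof.
move=> lm pp pS rs ps s0; have p0 := pp 0%N (leq0n k).
have [n [an sn]] := coho_supp_self (ideal_spanned s) p0 (coho_supp_seq p0 rs ps s0).
have [n' [nn' sn']] := coho_supp_chain pp pS sn.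
have [ik k1 _] := pp k (leqnn k).
have {}sn' := coho_supp_mono (local_max noethR lm ik k1) sn'.
suff H l : (l <= size s + k)%N -> exists t,
    [/\ size t = l, regular t & forall x, x \in t -> x \in m] by apply: H.
elim: l => [_|l IH lsk]; first by exists [::].
have [t [tl rt tm]] := IH (ltnW lsk).
have [|x [xm rx]] := regular_extend lm rt tm ik sn'.
  rewrite tl; apply: leq_trans nn'; rewrite -addnS.
  apply: (@leq_trans (a + size s + k)%N); first by rewrite -addnA leq_add2l.
  by rewrite leq_add2r.
exists (rcons t x); split=> // [|y]; first by rewrite size_rcons tl.
by rewrite mem_rcons inE => /orP[/eqP->|/tm].
Qed.

End InjectiveComplex.

(** * Free resolutions and Rees's theorem *)

Section Resolution.
Variable R : comNzRingType.
Hypothesis noethR : noetherian R.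

(** Projectivity of free modules in relational form: values are chosen on the standard basis. *)
Lemma free_select n (W : lmodType R) (rho : 'rV[R]_n -> W -> Prop) :
  linrel rho -> (forall a, exists w, rho a w) ->
  exists h : {linear 'rV[R]_n -> W}, forall a, rho a (h a).
Proof.
move=> [r0 rD] rT; have [w wP] := choice (fun i : 'I_n => rT 'e_i).
have [|h hE] := @linear_pack R 'rV[R]_n W (fun a => \sum_i a 0 i *: w i).
  move=> a u v; rewrite scaler_sumr -big_split /=; apply: eq_bigr => i _.
  by rewrite !mxE scalerA -scalerDl.
exists h => a; rewrite hE [X in rho X]row_sum_delta.
elim/big_ind2: _ => // [x x' y y' rx ry|i _]; last exact: linrelZ.
by rewrite -[x]scale1r -[x']scale1r; apply: rD.
Qed.

Lemma noeth_fg (V : lmodType R) (s : seq V) :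
  (forall x, gen (@zero_submod R V) s x) -> noeth (fun=> True) (@zero_submod R V).
Proof.
move=> sV.
suff H : noeth (gen (@zero_submod R V) s) (@zero_submod R V) by apply: noeth_sub H _.
elim: s {sV} => [|v s IH].
  move=> W sW WZ; exists [::]; split=> // x /WZ; exact.
apply: (@noeth_ext _ _ _ _ (gen (@zero_submod R V) s)); first exact: submod_gen.
  pose rho (r : R^o) (y : V) := gen (@zero_submod R V) s (y - r *: v).
  apply: (@noeth_rel _ _ _ rho _ _ _ _ _ (submod_zero _) _ (noeth_ring noethR)).
  - by split.
  - split=> [|a x x' y y' rxy rxy']; first by rewrite /rho scale0r subrr; apply: gen0.
    rewrite /rho scalerDl opprD addrACA -[(a *: x) *: v]scalerA -scalerBr.
    exact: (proj2 (submod_gen _ _)).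
  - by move=> x y rxy x0; move: rxy; rewrite /rho x0 scale0r subr0.
  - by move=> y /gen_cons[r gr]; exists r.
by apply: noeth_sub IH _ => x [].
Qed.

Lemma noeth_free n : noeth (fun=> True) (@zero_submod R 'rV[R]_n).
Proof.
apply: (@noeth_fg _ [seq 'e_i | i <- enum 'I_n]) => x.
rewrite [x]row_sum_delta => W sW _ Ws; elim/big_ind: _ => //.
- exact: submod0.
- by move=> y z; apply: submodD.
- by move=> i _; apply: (submodZ _ sW); apply: Ws; apply: map_f; rewrite mem_enum.
Qed.

Lemma free_gen (V : lmodType R) (s : seq V) :
  exists n (g : {linear 'rV[R]_n -> V}),
    forall x, gen (@zero_submod R V) s x <-> exists y, g y = x.
Proof.
exists (size s).
have [|g gE] := @linear_pack R 'rV[R]_(size s) V (fun a => \sum_i a 0 i *: s`_i).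
  move=> a u v; rewrite scaler_sumr -big_split /=; apply: eq_bigr => i _.
  by rewrite !mxE scalerA -scalerDl.
exists g => x; rewrite -spansP; split=> [[c ->]|[y <-]].
  by exists (\row_i c i); rewrite gE; apply: eq_bigr => i _; rewrite mxE.
by exists (fun i => y 0 i); rewrite gE.
Qed.

Lemma free_kernel n (V : lmodType R) (f : {linear 'rV[R]_n -> V}) :
  exists kg : {k & {linear 'rV[R]_k -> 'rV[R]_n}},
    forall x, f x = 0 <-> exists y, projT2 kg y = x.
Proof.
have sK : submod (fun x => f x = 0).
  by split=> [|a u v fu fv]; rewrite ?linear0 // linearP fu fv scaler0 addr0.
have [//|s [sf fs]] := noeth_free sK.
have [k [g gP]] := free_gen s; exists (existT _ k g) => x /=.
rewrite -gP; split=> [/fs//|gx]; apply: (gx _ sK) => // y ->.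
exact: linear0.
Qed.

Lemma free_resolution (M : lmodType R) : finitely_generated M ->
  exists (r : nat -> nat)
    (delta : forall i, {linear 'rV[R]_(r i.+1) -> 'rV[R]_(r i)})
    (eps : {linear 'rV[R]_(r 0%N) -> M}),
    [/\ forall x, exists y, eps y = x,
        forall x, eps x = 0 <-> exists y, delta 0%N y = x &
        forall i x, delta i x = 0 <-> exists y, delta i.+1 y = x].
Proof.
move=> [s sM]; have [n [eps epsP]] := free_gen s.
(* Bundling the codomain with each map out of a free module lets [iter] repeat the covering of
   kernels. *)
pose state := {n : nat & {V : lmodType R & {linear 'rV[R]_n -> V}}}.
pose kg (S : state) := cid (free_kernel (projT2 (projT2 S))).
pose next (S : state) : state :=
  existT _ (projT1 (sval (kg S)))
    (existT (fun V : lmodType R => {linear 'rV[R]_(projT1 (sval (kg S))) -> V})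
       ('rV[R]_(projT1 S) : lmodType R) (projT2 (sval (kg S)))).
pose st i : state := iter i next
  (existT _ n (existT (fun V : lmodType R => {linear 'rV[R]_n -> V}) M eps)).
exists (fun i => projT1 (st i)), (fun i => projT2 (sval (kg (st i)))), eps.
split=> [x|x|i x].
- by apply/epsP/spansP.
- exact: (svalP (kg (st 0%N))).
- exact: (svalP (kg (st i.+1))).
Qed.

End Resolution.

(** * Regular sequences from vanishing Ext *)

Section Rees.
Variable R : comNzRingType.
Hypothesis noethR : noetherian R.
Variables (M : lmodType R) (r : nat -> nat).
Variable delta : forall i, {linear 'rV[R]_(r i.+1) -> 'rV[R]_(r i)}.
Variable eps : {linear 'rV[R]_(r 0%N) -> M}.
Hypothesis eps_surj : forall x, exists y, eps y = x.
Hypothesis eps_delta : forall x, eps (delta 0%N x) = 0.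
Hypothesis delta_delta : forall i x, delta i (delta i.+1 x) = 0.
Hypothesis fgM : finitely_generated M.
Implicit Types (J : R -> Prop).

(* ext_zero J i says that Ext^i(M, R/J) = 0, representing cochains with       *)
(* values in R/J by R-valued ones (the resolution is free).                   *)
Definition ext_cob J i : ('rV[R]_(r i) -> R) -> Prop :=
  match i with
  | 0 => fun f => forall x, J (f x)
  | k.+1 => fun f => exists h : {linear 'rV[R]_(r k) -> R^o},
      forall x, J (f x - h (delta k x))
  end.

Definition ext_zero J i : Prop := forall f : {linear 'rV[R]_(r i) -> R^o},
  (forall x, J (f (delta i x))) -> ext_cob J f.

(** Long exact sequence of 0 -> R/J -> R/J -> R/(J + x) -> 0: the connecting cocycle [u] is f delta
    divided by x modulo J, and if [h] bounds it then f - x h is a cocycle modulo J. *)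
Lemma ext_zero_adj J i x : ideal J -> (forall c, J (x * c) -> J c) ->
  ext_zero J i -> ext_zero J i.+1 -> ext_zero (adj J x) i.
Proof.
move=> iJ Jx zi zi1 f fJ.
have [||u uP] := @free_select R (r i.+1) R^o (fun a u => J (f (delta i a) - u * x)).
- split=> [|a y y' u u' Ju Ju'].
    by rewrite !linear0 mul0r subr0; apply: ideal0.
  rewrite !linearP; have -> : a *: f (delta i y) + f (delta i y') - (a *: u + u') * x
    = a * (f (delta i y) - u * x) + (f (delta i y') - u' * x).
    by rewrite /GRing.scale /=; ring.
  by apply: idealD => //; apply: ideal_mull.
- by move=> a; have [c Jc] := fJ a; exists c.
have [|h hP] := zi1 u.
  move=> y; apply: Jx; have := uP (delta i.+1 y).
  rewrite delta_delta linear0 sub0r => Ju.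
  have -> : x * u (delta i.+1 y) = -1 * - (u (delta i.+1 y) * x) by ring.
  exact: ideal_mull.
have [g gE] : exists g : {linear 'rV[R]_(r i) -> R^o}, forall y, g y = f y - x * h y.
  apply: linear_pack => a y y'; rewrite !linearP /GRing.scale /=; ring.
have : ext_cob J g.
  apply: zi => y; rewrite gE.
  have -> : f (delta i y) - x * h (delta i y) =
    (f (delta i y) - u y * x) + x * (u y - h (delta i y)) by ring.
  by apply: idealD => //; apply: ideal_mull.
have adjf c e : J (f c - x * h c - e) -> adj J x (f c - e).
  by move=> Jc; exists (h c); rewrite addrAC mulrC.
case: i f fJ u uP h hP g gE adjf {zi zi1} => [|i] f fJ u uP h hP g gE adjf /=.
  by move=> gJ y; rewrite -[f y]subr0; apply: adjf; rewrite subr0 -gE.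
by move=> [h' gJ]; exists h' => y; apply: adjf; rewrite -gE.
Qed.

Lemma noeth_M : noeth (fun=> True) (@zero_submod R M).
Proof. by have [s sM] := fgM; apply: (@noeth_fg _ noethR _ s) => x; apply/spansP. Qed.

(** If no element of q prolongs s, then q lies in a prime p = ((s) : w). As M is nonzero at p,
    Nakayama's lemma yields a nonzero map M -> R/p; followed by the embedding of R/p in R/(s) given
    by w, it contradicts Ext^0(M, R/(s)) = 0. *)
Lemma regular_of_ext g q : prime_pred q ->
    (exists e : M, forall c, ~ q c -> c *: e <> 0) ->
    (forall i, (i < g)%N -> ext_zero (@zero_submod R R^o) i) ->
  exists s, [/\ size s = g, regular s & forall x, x \in s -> q x].
Proof.
move=> pq [e qe] zg.
suff H t : (t <= g)%N -> exists s, [/\ size s = t, regular s, forall x, x \in s -> q x &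
    forall i, (i + t < g)%N -> ext_zero (spanned s) i].
  by have [s [? ? ? _]] := H g (leqnn g); exists s.
elim: t => [_|t IH tg].
  exists [::]; split=> // i; rewrite addn0 /spanned igen_nil; exact: zg.
have [s [st rs qs zs]] := IH (ltnW tg); have is_ := ideal_spanned s.
suff [x [qx sx]] : exists x, q x /\ forall c, spanned s (x * c) -> spanned s c.
  exists (rcons s x); split.
  - by rewrite size_rcons st.
  - exact/regular_rcons.
  - by move=> y; rewrite mem_rcons inE => /orP[/eqP->|/qs].
  - move=> i; rewrite addnS spanned_rcons => ig; apply: ext_zero_adj => //.
      by apply: zs; apply: ltnW.
    by apply: zs; rewrite addSn.
apply: contrapT => nox.
have [|w [sw pw qw]] := zerodivisor_ideal noethR is_ (ideal_prime pq).
  move=> z qz; apply: contrapT => zns; apply: nox; exists z; split=> // c szc.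
  by apply: contrapT => sc; apply: zns; exists c.
have [||W [v [s0 [sW _ _ ws0 [Ws Wv]]]]] :=
  nakayama (submod_zero M) noeth_M _ pw; first by split.
  exists e; split=> // c wc; apply: qe => qc; apply: wc; exact: qw.
(* Lifts to the free cover the map M -> R/p sending m to the r with s0 m = r v modulo [W]. *)
have [||l lP] := @free_select R (r 0%N) R^o (fun a u => W (s0 *: eps a - u *: v)).
- split=> [|a y y' u u' Wu Wu'].
    by rewrite linear0 scaler0 scale0r subr0; apply: submod0.
  rewrite linearP scalerDr scalerDl opprD addrACA scalerA mulrC -!scalerA -scalerBr.
  exact: sW.2.
- by move=> a; apply: Ws.
have [f fE] : exists f : {linear 'rV[R]_(r 0%N) -> R^o}, forall y, f y = l y * w.
  by apply: linear_pack => a y y'; rewrite linearP /GRing.scale /=; ring.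
have lW : forall y, colon (spanned s) w (l y).
  move=> y; rewrite /colon -fE; apply: (zs 0%N) => // {}y; rewrite fE; apply: Wv.
  have := lP (delta 0%N y); rewrite eps_delta scaler0 sub0r => Wl.
  by rewrite -[_ *: v]opprK -scaleN1r; apply: (submodZ _ sW).
have [y vy] := eps_surj v.
apply: ws0; rewrite -(subrK (l y) s0); apply: (idealD (ideal_prime pw)) => //.
by apply: Wv; rewrite scalerBl -{1}vy.
Qed.

End Rees.

(** * Reading Ext off a free resolution *)

Section FreeProjectiveResolution.
Variable R : comNzRingType.
Variables (M : lmodType R) (r : nat -> nat).
Variable delta : forall i, {linear 'rV[R]_(r i.+1) -> 'rV[R]_(r i)}.
Variable eps : {linear 'rV[R]_(r 0%N) -> M}.
Hypothesis eps_surj : forall x, exists y, eps y = x.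
Hypothesis eps_exact : forall x, eps x = 0 <-> exists y, delta 0%N y = x.
Hypothesis delta_exact : forall i x, delta i x = 0 <-> exists y, delta i.+1 y = x.

Definition res_rank (i : int) : nat := if i is Posz k then r k else 0%N.

Definition res_obj (i : int) : lmodType R := 'rV[R]_(res_rank i).

(** [conform_mx] transports the matrix of [delta] to ranks that match its size only once i = j + 1
    and j >= 0 are known. *)
Definition res_mx (i j : int) : 'M[R]_(res_rank i, res_rank j) :=
  if (i == j + 1) && (0 <= j) then conform_mx 0 (lin1_mx (delta `|j|)) else 0.

Definition res_diff (i j : int) : {linear res_obj i -> res_obj j} :=
  mulmxr (res_mx i j).

Lemma res_diffS k x : res_diff k.+1%:Z k%:Z x = delta k x.
Proof.
rewrite /= /res_mx; have -> : (k.+1%:Z == k%:Z + 1) by rewrite -addn1 PoszD eqxx.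
by rewrite /= conform_mx_id mul_rV_lin1.
Qed.

Lemma res_diff_out i j x : ~ (exists k : nat, i = k.+1%:Z /\ j = k%:Z) ->
  res_diff i j x = 0.
Proof.
move=> nij; rewrite /= /res_mx; case: ifP => [|_]; last by rewrite mulmx0.
case/andP => /eqP ij j0; case: nij; exists `|j|%N; lia.
Qed.

Fact res_diff_shape i j : i != j + 1 -> res_diff i j =1 \0.
Proof. by move=> ij x; apply: res_diff_out => -[k [ik jk]]; move: ij; lia. Qed.

Fact res_diff_diff i j k : res_diff j k \o res_diff i j =1 \0.
Proof.
move=> x; rewrite -[(_ \o _) x]/(res_diff j k (res_diff i j x)).
have [|nij] := pselect (exists k : nat, i = k.+1%:Z /\ j = k%:Z); last first.
  by rewrite (res_diff_out _ nij) linear0.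
move=> [l [il jl]]; rewrite {}il {}jl {i j} in x *.
have [|njk] := pselect (exists i : nat, l%:Z = i.+1%:Z /\ k = i%:Z); last first.
  exact: res_diff_out.
move=> [n [[ln] ->]]; rewrite {}ln in x *.
by rewrite !res_diffS; apply/delta_exact; exists x.
Qed.

Definition res_complex : complex R := Complex res_diff_shape res_diff_diff.

Lemma projective_free n : projective_module ('rV[R]_n : lmodType R).
Proof.
move=> U V f g fs.
have [||h hP] := @free_select R n U (fun a u => f u = g a); last by exists h.
  split=> [|a x x' y y' e e']; first by rewrite !linear0.
  by rewrite !linearP e e'.
by move=> a; apply: fs.
Qed.

Lemma res_ge0 (i : int) : i < 0 -> ~ nonzero_module (res_complex i).
Proof. by case: i => // n _ [x]; rewrite [x]thinmx0 eqxx. Qed.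

Lemma homology_zero (X : complex R) (i j k : int) : j = i - 1 -> k = i + 1 ->
    (forall x, diff X i j x = 0 -> exists y, diff X k i y = x) ->
  ~ nonzero_module (homology X i).
Proof.
move=> -> -> ex [h /eqP]; apply; have [z <-] := quotient_pi_surj h.
have [pi piE] := linear_pack (@quotient_pi_linear R _ (@boundaries R X i)).
rewrite -piE -[RHS](linear0 pi) !piE; apply/quotient_piP; rewrite subr0.
by apply/asboolP/ex/eqP; apply: (valP z).
Qed.

Lemma res_acyclic (i : int) : 0 < i -> ~ nonzero_module (homology res_complex i).
Proof.
case: i => [[|k]|] // _; apply: (@homology_zero _ _ k%:Z k.+2%:Z); [lia|lia|].
move=> x; rewrite [diff _]/= res_diffS => /delta_exact[y <-].
by exists y; rewrite -res_diffS.
Qed.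

Definition free_projective_resolution : projective_resolution M.
Proof.
apply: (@ProjectiveResolution _ M res_complex _ res_ge0 res_acyclic eps eps_surj).
  by move=> i; apply: projective_free.
move=> x; rewrite eps_exact; split=> -[y <-]; exists y.
  by rewrite -res_diffS.
by rewrite -res_diffS.
Defined.

(** The degrees n, n + 1 and n - 1 are variables tied by equations, which avoids casts from the
    doubly negated indices of the Hom complex. *)
Lemma Ext_zero_cob (P : projective_resolution M) (n : nat) (j j1 j0 : int) :
    ~ nonzero_module (Ext n P R^o) ->
    j = - - n%:Z -> j1 = - (- n%:Z - 1) -> j0 = - (- n%:Z + 1) ->
  forall f : {linear P j -> R^o}, (forall x, f (diff P j1 j x) = 0) ->
  exists h : {linear P j0 -> R^o}, forall x, f x = h (diff P j j0 x).
Proof.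
move=> nE -> -> -> f f0.
have fl : (f : P (- - n%:Z) -> R^o) \in @linear_function R _ _.
  by apply/asboolP; apply: linearP.
pose g : hom_complex P R^o (- n%:Z) := Sub (f : P (- - n%:Z) -> R^o) fl.
have gc : g \in @cycles R (hom_complex P R^o) (- n%:Z).
  by rewrite unfold_in /cycles; apply/eqP/val_inj/funext => x; apply: f0.
pose z : submodule (@cycles R (hom_complex P R^o) (- n%:Z)) := Sub g gc.
have : quotient_pi (@boundaries R (hom_complex P R^o) (- n%:Z)) z =
       quotient_pi (@boundaries R (hom_complex P R^o) (- n%:Z)) 0.
  apply: contrapT => zn; apply: nE.
  exists (quotient_pi (@boundaries R (hom_complex P R^o) (- n%:Z)) z).
  apply/eqP => z0; apply: zn; rewrite z0.
  have [pi piE] := linear_pack (@quotient_pi_linear R _ (@boundaries R (hom_complex P R^o) (- n%:Z))).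
  by rewrite -piE linear0.
move=> /quotient_piP; rewrite subr0 => /asboolP[y yz].
have [h hE] := linear_pack (elimT (asboolP _) (valP y)).
exists h => x; rewrite hE.
by have /(congr1 (fun u => val u x)) := yz.
Qed.

Lemma free_ext_zero (n : nat) :
  (forall P : projective_resolution M, ~ nonzero_module (Ext n P R^o)) ->
  ext_zero delta (@zero_submod R R^o) n.
Proof.
move=> /(_ free_projective_resolution) nE f f0.
case: n nE f f0 => [|n] nE f f0.
  have [|||x|h hE] := @Ext_zero_cob free_projective_resolution 0 0%:Z 1%:Z (- 1%:Z) nE _ _ _ f.
  - by [].
  - by [].
  - by [].
  - by rewrite -[diff _ _ _ x]/(res_diff _ _ x) res_diffS; apply: f0.
  (* The resolution is zero in degree -1, so a coboundary of degree 0 vanishes. *)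
  - move=> x; rewrite /zero_submod hE -[RHS](linear0 h); congr (h _).
    exact: thinmx0.
have [|||x|h hE] := @Ext_zero_cob free_projective_resolution n.+1 n.+1%:Z n.+2%:Z n%:Z nE _ _ _ f.
- lia.
- lia.
- lia.
- by rewrite -[diff _ _ _ x]/(res_diff _ _ x) res_diffS; apply: f0.
exists h => x; apply/eqP; rewrite subr_eq0 hE; apply/eqP; congr (h _).
by rewrite -res_diffS.
Qed.

End FreeProjectiveResolution.

(** * Quasi-injective resolutions *)

Section ExtendedIntegers.
Local Open Scope classical_set_scope.
Implicit Types (A : set (\bar int)).

Definition finite_elements A : Prop := forall x, A x -> exists i : int, x = i%:E.

Lemma int_max (S : int -> Prop) (n x : int) : (forall i, S i -> i <= n) -> S x ->
  exists y, S y /\ forall i, S i -> i <= y.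
Proof.
move=> Sn Sx; pose Q k := `[< S (n - k%:Z) >].
have exQ : exists k, Q k.
  exists `|n - x|%N; apply/asboolP; have xn := Sn x Sx.
  by have -> : n - `|n - x|%N%:Z = x by lia.
have [k /asboolP Sk kmin] := ex_minnP exQ.
exists (n - k%:Z); split=> // i Si; have := kmin `|n - i|%N; have ni := Sn i Si.
have -> : Q `|n - i|%N by apply/asboolP; have -> : n - `|n - i|%N%:Z = i by lia.
by move=> /(_ isT); lia.
Qed.

(** [supremum] is meaningful only if a least upper bound exists; for a set of integers it is
    attained, or -oo for the empty set, or +oo. *)
Lemma fin_supremums A : finite_elements A -> supremums A !=set0.
Proof.
move=> fA; have [->|/set0P[x0 Ax0]] := eqVneq A set0.
  by exists -oo%E; split=> [y []|y _]; rewrite leNye.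
have [i0 e0] := fA x0 Ax0; rewrite {}e0 in Ax0.
have [[n An]|nb] := pselect (exists n : int, forall i : int, A i%:E -> i <= n).
  have [y [Ay ymax]] := int_max An Ax0.
  exists y%:E; split=> [x Ax|z]; last by apply.
  by have [i ei] := fA x Ax; rewrite ei lee_fin; apply: ymax; rewrite -ei.
exists +oo%E; split=> [y _|[z| |] zA]; rewrite ?leey //.
  by case: nb; exists z => i /zA; rewrite lee_fin.
by have := zA _ Ax0.
Qed.

Lemma fin_infimums A : finite_elements A -> infimums A !=set0.
Proof.
move=> fA; have [->|/set0P[x0 Ax0]] := eqVneq A set0.
  by exists +oo%E; split=> [y []|y _]; rewrite leey.
have [i0 e0] := fA x0 Ax0; rewrite {}e0 in Ax0.
have [[n An]|nb] := pselect (exists n : int, forall i : int, A i%:E -> n <= i).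
  have [||y [Ay ymin]] := @int_max (fun i => A (- i)%:E) (- n) (- i0).
  - by move=> i /An; lia.
  - by rewrite opprK.
  exists (- y)%:E; split=> [x Ax|z]; last by apply.
  have [i ei] := fA x Ax; rewrite ei lee_fin.
  by have := ymin (- i); rewrite opprK -ei => /(_ Ax); lia.
exists -oo%E; split=> [y _|[z| |] zA]; rewrite ?leNye //.
  by case: nb; exists z => i /zA; rewrite lee_fin.
by have := zA _ Ax0.
Qed.

Lemma esup_ub A x : finite_elements A -> A x -> (x <= esup A)%E.
Proof. by move=> /fin_supremums; apply: ge_supremum_Nmem. Qed.

Lemma einf_lb A x : finite_elements A -> A x -> (einf A <= x)%E.
Proof. by move=> /fin_infimums; apply: le_infimum_Nmem. Qed.

Lemma esup_le A y : finite_elements A -> (forall x, A x -> (x <= y)%E) ->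
  (esup A <= y)%E.
Proof.
move=> /fin_supremums[s sA] Ay; rewrite /esup /supremum; case: ifPn => _.
  exact: leNye.
by case: xgetP => [z _ [_ zA]|/(_ s)//]; apply: zA.
Qed.

Lemma einf_ge A y : finite_elements A -> (forall x, A x -> (y <= x)%E) ->
  (y <= einf A)%E.
Proof.
move=> /fin_infimums[s sA] Ay; rewrite /einf /infimum; case: ifPn => _.
  exact: leey.
by case: xgetP => [z _ [_ zA]|/(_ s)//]; apply: zA.
Qed.

Lemma fin_image T (f : T -> int) (S : set T) :
  finite_elements [set (f n)%:E | n in S].
Proof. by move=> _ [n _ <-]; exists (f n). Qed.

Lemma esup_mem A (i : int) : finite_elements A -> esup A = i%:E -> A i%:E.
Proof.
move=> fA eA; apply: contrapT => nAi.
have : (esup A <= (i - 1)%:E)%E.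
  apply: esup_le => // x Ax; have := esup_ub fA Ax; have [j ej] := fA x Ax.
  rewrite eA ej !lee_fin => ji; have : j != i by apply: contra_notN nAi => /eqP <-; rewrite -ej.
  lia.
by rewrite eA lee_fin; lia.
Qed.

Lemma esup_pinfty A (k : int) : finite_elements A -> esup A = +oo%E ->
  exists i, A i%:E /\ k < i.
Proof.
move=> fA eA; apply: contrapT => nAk; have : (esup A <= k%:E)%E.
  apply: esup_le => // x Ax; have [j ej] := fA x Ax; rewrite ej lee_fin leNgt.
  by apply/negP => kj; apply: nAk; exists j; rewrite -ej.
by rewrite eA.
Qed.

Lemma einf_pinfty A : einf A != +oo%E -> A !=set0.
Proof. by move=> eA; apply/set0P; apply: contra eA => /eqP ->; rewrite /einf /infimum eqxx. Qed.

End ExtendedIntegers.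

Section QuasiInjective.
Variable R : comNzRingType.

Lemma nonzeroPn (V : lmodType R) (x : V) : ~ nonzero_module V -> x = 0.
Proof. by move=> nV; apply/eqP; apply: contrapT => /negP xn0; apply: nV; exists x. Qed.

Lemma bounded_complex (X : complex R) (i : int) : bounded_above X -> bounded X ->
    (i%:E <= csup X)%E ->
  exists hi lo : int, csup X = hi%:E /\
    forall j, (hi < j) || (j < lo) -> ~ nonzero_module (X j).
Proof.
rewrite /bounded_above /bounded => sX bX iX.
have fX := @fin_image _ id [set i : int | nonzero_module (X i)]%classic.
case es : (csup X) sX bX iX => [hi| |] // _ bX _.
have inf_lb j : nonzero_module (X j) -> (cinf X <= j%:E)%E.
  by move=> Xj; apply: einf_lb => //; exists j.
have sup_ub j : nonzero_module (X j) -> j <= hi.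
  by move=> Xj; rewrite -lee_fin -es; apply: esup_ub => //; exists j.
case ei : (cinf X) bX inf_lb => [lo| |] // _ inf_lb.
  exists hi, lo; split=> // j + /[dup] /sup_ub jhi /inf_lb; rewrite lee_fin; lia.
exists hi, 0; split=> // j _ /inf_lb.
by rewrite leye_eq.
Qed.

(** [rho u y] means that y is a cycle whose class corresponds to u, so that quotients disappear from
    later arguments. *)
Lemma homology_rel (X : complex R) (N : lmodType R) (i j k : int) :
    j = i - 1 -> k = i + 1 -> iso_module (homology X i) N ->
  exists rho : N -> X i -> Prop, [/\ linrel rho, forall u, exists y, rho u y,
    forall y, diff X i j y = 0 -> exists u, rho u y &
    forall u y, rho u y ->
      diff X i j y = 0 /\ (u = 0 <-> exists x, diff X k i x = y)].
Proof.
move=> -> -> [phi [psi phiK psiK]].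
have [pi piE] := linear_pack (@quotient_pi_linear R _ (@boundaries R X i)).
exists (fun u y => exists z : submodule (@cycles R X i), val z = y /\ phi (pi z) = u).
split.
- split=> [|a u u' y y' [z [<- <-]] [z' [<- <-]]].
    by exists 0; rewrite !linear0.
  by exists (a *: z + z'); rewrite !linearP.
- move=> u; have [z zu] := quotient_pi_surj (psi u).
  by exists (val z), z; split=> //; rewrite piE zu psiK.
- move=> y dy; have yc : y \in @cycles R X i by apply/eqP.
  by exists (phi (pi (Sub y yc))), (Sub y yc); rewrite SubK.
move=> u y [z [<- <-]]; split; first exact/eqP/(valP z).
have piz : pi z = 0 <-> exists x, diff X (i + 1) i x = val z.
  rewrite -(linear0 pi) !piE; split=> [/quotient_piP|zb].
    by rewrite subr0 => /asboolP.
  by apply/quotient_piP; rewrite subr0; apply/asboolP.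
rewrite -piz; split=> [|->]; last by rewrite linear0.
by rewrite -[X in _ = X](linear0 phi) => /(can_inj phiK).
Qed.

Lemma ffun_gen (M : lmodType R) b (s : seq M) :
    (forall x, gen (@zero_submod R M) s x) ->
  forall f : {ffun 'I_b -> M}, gen (@zero_submod R {ffun 'I_b -> M})
    [seq [ffun j => if j == i then v else 0] | i <- enum 'I_b, v <- s] f.
Proof.
move=> sM f W sW _ Ws.
pose del i v : {ffun 'I_b -> M} := [ffun j => if j == i then v else 0].
have -> : f = \sum_i del i (f i).
  apply/ffunP => j; rewrite sum_ffunE (bigD1 j) //= ffunE eqxx big1 ?addr0 //.
  by move=> i ij; rewrite ffunE eq_sym (negPf ij).
elim/big_ind: _ => //; first exact: submod0.
  by move=> x y; apply: submodD.
move=> i _; apply: (sM (f i) (fun v => W (del i v))) => [|v ->|v vs].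
- have del0 : del i 0 = 0 by apply/ffunP => j; rewrite !ffunE; case: ifP.
  split=> [|a x y Wx Wy]; first by rewrite del0; apply: submod0.
  have -> : del i (a *: x + y) = a *: del i x + del i y.
    by apply/ffunP => j; rewrite !ffunE; case: ifP => // _; rewrite scaler0 addr0.
  exact: sW.2.
- have -> : del i 0 = 0 by apply/ffunP => j; rewrite !ffunE; case: ifP.
  exact: submod0.
- by apply: Ws; apply/allpairsP; exists (i, v); rewrite /= mem_enum.
Qed.

Hypothesis noethR : noetherian R.

Lemma qid_regular (m : idealr R) (M : lmodType R) (X : complex R)
    (p : nat -> prime_idealr R) (k : nat) (s : seq R) :
    local_ring m -> finitely_generated M -> quasi_injective_resolution M X ->
    bounded X -> Defs.support M (p 0%N) ->
    (forall i, (i < k)%N -> {subset p i <= p i.+1} /\ ~ {subset p i.+1 <= p i}) ->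
    regular s -> (forall x, x \in s -> x \in p 0%N) ->
  exists t, [/\ size t = (size s + k)%N, regular t & forall x, x \in t -> x \in m].
Proof.
move=> lm [sM fgM] [bX injX [b [[i0 i0X bi0] Hb]]] bdX [e pe] pS rs ps.
have [hi [lo [Xhi Xz]]] := bounded_complex bX bdX i0X.
rewrite {}Xhi in i0X Hb.
(* I 0 sits one degree above sup X, hence is zero, and E^n(R), computed at I (n+1), is the homology
   of X in degree hi - n. *)
pose I n : lmodType R := X (hi + 1 - n%:Z).
pose d n : {linear I n -> I n.+1} := diff X (hi + 1 - n%:Z) (hi + 1 - n.+1%:Z).
have H n : exists rho : {ffun 'I_(b (hi + 1 - n.+1%:Z)) -> M} -> I n.+1 -> Prop,
  [/\ linrel rho, forall u, exists y, rho u y,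
    forall y, d n.+1 y = 0 -> exists u, rho u y &
    forall u y, rho u y ->
      d n.+1 y = 0 /\ (u = 0 <-> exists x, d n x = y)].
  by apply: homology_rel; [lia|lia|apply: Hb; rewrite lee_fin; lia].
have dd n x : d n.+1 (d n x) = 0 by apply: diff_diff.
have injI n : injective_module (I n) by apply: injX.
have I0 (x : I 0%N) : x = 0 by apply/nonzeroPn/Xz; lia.
have coch0 n (y : I n) : coch (@zero_submod R R^o) y by move=> r ->; rewrite scale0r.
have cobP n (y : I n.+1) : cob d (@zero_submod R R^o) y <-> exists x, d n x = y.
  by split=> [[x [_ ->]]|[x <-]]; exists x => //; split=> //; apply: coch0.
have noethI n : noeth (@coc R I d (@zero_submod R R^o) n)
    (@cob R I d (@zero_submod R R^o) n).
  have [rho [lrho _ rhoS rhoK]] := H n.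
  have nM : noeth (fun=> True) (@zero_submod R {ffun 'I_(b (hi + 1 - n.+1%:Z)) -> M}).
    apply: (@noeth_fg _ noethR) => f; apply: (@ffun_gen M _ sM) => x.
    exact: (proj1 (spansP _ _) (fgM x)).
  apply: (@noeth_rel _ _ _ rho _ _ _ _ _ (submod_zero _) lrho nM).
  - by split.
  - by move=> u y /rhoK[_ uy] u0; apply/cobP; apply: (proj1 uy).
  - by move=> y [_ /rhoS[u]]; exists u.
have suppI n : b (hi + 1 - n.+1%:Z) != 0%N ->
    coho_supp d (@zero_submod R R^o) n (fun r => r \in p 0%N).
  move=> bn; have [rho [lrho rhoT _ rhoK]] := H n.
  (* The tuple with all entries [e] survives localization at [p 0], as [e] does and there is at
     least one entry. *)
  have [y rey] := rhoT [ffun=> e]; have [dy _] := rhoK _ _ rey.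
  exists y; split; first by split=> //; apply: coch0.
  move=> c pc /cobP cy.
  have /ffunP ce0 := (rhoK _ _ (linrelZ c lrho rey)).2.2 cy.
  have bn' : (0 < b (hi + 1 - n.+1%:Z)%R)%N by rewrite lt0n.
  have := ce0 (Ordinal bn'); rewrite !ffunE.
  by move/eqP; apply/negP; apply: pe; apply/negP.
have highI n : b (hi + 1 - n.+1%:Z) = 0%N -> coho_zero d (@zero_submod R R^o) n.
  move=> bn y [_ dy]; have [rho [_ _ rhoS rhoK]] := H n.
  have [u ruy] := rhoS y dy; apply/cobP/(rhoK _ _ ruy).2.
  by apply/ffunP => -[j jb]; exfalso; move: (jb); rewrite bn.
have Ihigh n (x : I n) : (absz (hi + 1 - lo)%R < n)%N -> x = 0.
  by move=> hn; apply/nonzeroPn/Xz; lia.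
pose Q n := b (hi + 1 - n.+1%:Z) != 0%N.
have exQ : exists n, Q n.
  exists `|hi - i0|%N; move: i0X; rewrite /Q lee_fin => i0X.
  by have -> : hi + 1 - `|hi - i0|%N.+1%:Z = i0 by lia.
have bQ n : Q n -> (n <= absz (hi + 1 - lo)%R)%N.
  move=> /suppI[y [_ py]]; rewrite leqNgt; apply/negP => hn.
  apply: (py 1); first by rewrite idealr1.
  by rewrite (Ihigh _ y (leqW hn)) scaler0; apply: (submod0 (submod_cob _ _ _)).
have [a Qa amax] := ex_maxnP exQ bQ.
have high n : (a < n)%N -> coho_zero d (@zero_submod R R^o) n.
  move=> an; apply: highI; apply/eqP; apply: contraTT an => Qn.
  by rewrite -leqNgt; apply: amax.
apply: (regular_of_chain noethR dd injI I0 noethI high Ihigh (p := fun i r => r \in p i) lm) => //.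
- by move=> i _; apply: prime_idealr_pred.
- move=> i /pS[pp pn]; split=> //; apply: contrapT => nox; apply: pn => x px.
  by apply: contrapT => npx; apply: nox; exists x.
exact: suppI.
Qed.

End QuasiInjective.

(** * Depth and dimension *)

Section Depth.
Variable R : comNzRingType.
Hypothesis noethR : noetherian R.
Implicit Types (J P : R -> Prop).

(* An ideal containing J and maximal among those disjoint from the products   *)
(* s x^j with s outside P is prime.                                           *)
Lemma prime_below J P x : ideal J -> prime_pred P -> (forall r, J r -> P r) ->
    (forall r, J (x * r) -> J r) ->
  exists P', [/\ prime_pred P', forall r, J r -> P' r,
    forall r, P' r -> P r & ~ P' x].
Proof.
move=> iJ [iP P1 pP] JP Jx.
pose F K := [/\ ideal K, forall r, J r -> K r & forall s j, ~ P s -> ~ K (s * x ^+ j)].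
have [||K [[iK JK KP] Kmax]] := @ideal_max R noethR F; first by move=> K [].
  exists J; split=> // s j Ps Jsx; apply/Ps/JP; elim: j Jsx => [|j IH].
    by rewrite expr0 mulr1.
  by rewrite exprS mulrCA => /Jx.
have Kx a : ~ K a -> exists s j c, ~ P s /\ K (s * x ^+ j - c * a).
  move=> Ka; apply: contrapT => nos; apply/Ka/(Kmax (adj K a)).
  - split=> [|r Jr|s j Ps [c Kc]]; first exact: ideal_adj.
      by apply: adj_sub; apply: JK.
    by apply: nos; exists s, j, c.
  - by move=> r; apply: adj_sub.
  - exact: adj_mem.
exists K; split=> //.
- split=> // [K1|a b Kab]; first by apply: (KP 1 0%N) => //; rewrite expr0 mulr1.
  apply: contrapT => /not_orP[/Kx[s [i [c [Ps Kc]]]] /Kx[t [j [e [Pt Ke]]]]].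
  apply: (KP (s * t) (i + j)%N) => [/pP[]//|].
  have -> : s * t * x ^+ (i + j) = (t * x ^+ j) * (s * x ^+ i - c * a) +
    (c * a * (t * x ^+ j - e * b) + c * e * (a * b)) by rewrite exprD; ring.
  by do !(apply: idealD => //); apply: ideal_mull.
- move=> r Kr; apply: contrapT => Pr; apply: (KP r 0%N) => //.
  by rewrite expr0 mulr1.
- by move=> xK; apply: (KP 1 1%N) => //; rewrite mul1r expr1.
Qed.

(** The last element x is a nonzerodivisor modulo the others, so [prime_below] descends from P to a
    prime containing the others but not x, where the induction continues. *)
Lemma regular_chain s P : regular s -> prime_pred P -> (forall x, x \in s -> P x) ->
  exists p : nat -> R -> Prop, [/\ forall i, prime_pred (p i), p (size s) = P &
    forall i, (i < size s)%N ->
      (forall r, p i r -> p i.+1 r) /\ exists x, p i.+1 x /\ ~ p i x].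
Proof.
elim/last_ind: s P => [|s x IH] P; first by move=> _ pP _; exists (fun=> P).
move=> /regular_rcons[rs sx] pP xP.
have [|P' [pP' sP' PP' xP']] := prime_below (ideal_spanned s) pP _ sx.
  move=> r sr; apply: (sr _ (ideal_prime pP)) => [y ->|y ys].
    exact: ideal0 (ideal_prime pP).
  by apply: xP; rewrite mem_rcons inE ys orbT.
have [|p [pp ps pS]] := IH P' rs pP'; first by move=> y ys; apply: sP'; apply: gen_mem.
exists (fun i => if (i <= size s)%N then p i else P); rewrite size_rcons.
split=> [i||i]; [by case: ifP|by rewrite ltnn|rewrite ltnS => si].
rewrite si; case: ltnP => [/pS//|si'].
have -> : i = size s by apply/eqP; rewrite eqn_leq si.
rewrite ps; split=> //; exists x; split=> //.
by apply: xP; rewrite mem_rcons inE eqxx.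
Qed.

Lemma depth_le_dim (m : idealr R) : local_ring m -> (depth m <= krull_dim R)%E.
Proof.
move=> lm; apply: esup_le => [|_ [n [a [<- am [ra _]]] <-]]; first exact: fin_image.
have [|||p [pp _ pS]] := @regular_chain a (fun r => r \in m).
- by move=> i r ia /spansP sa; apply/spansP; apply: ra.
- exact: local_prime.
- by [].
have [q qP] := choice (fun i => prime_idealr_pack (pp i)).
apply: esup_ub; first exact: fin_image.
exists (size a) => //; exists q; split=> // i /pS[pi [x [px npx]]].
split=> [r /qP/pi/qP//|qq]; apply: npx; apply/qP/qq/qP => //.
Qed.

End Depth.

Theorem corollary1p4 (R : comNzRingType) (m : idealr R)
    (noethR : noetherian R) (localR : local_ring m) :
  (exists M : lmodType R,
     [/\ nonzero_module M, finitely_generated M,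
         (qid M < +oo)%E &
         krull_dim R = (module_dim M + grade M)%E]) ->
  cohen_macaulay m.
Proof.
move=> [M [[e e0] fgM qM dimR]]; apply/eqP; rewrite eq_le depth_le_dim //= dimR.
have [_ [X [resX bX _]]] := einf_pinfty (negbT (lt_eqF qM)).
(* Stated for a single chain and a single range of vanishing Ext, so that infinite values of dim M
   and grade M are covered too. *)
have depth_ge k g : (exists p : nat -> prime_idealr R,
      (forall i, (i <= k)%N -> Defs.support M (p i)) /\
      (forall i, (i < k)%N ->
         {subset p i <= p i.+1} /\ ~ {subset p i.+1 <= p i})) ->
    (forall (i : nat) (P : projective_resolution M), (i < g)%N ->
      ~ nonzero_module (Ext i P R^o)) ->
    ((g + k)%N%:Z%:E <= depth m)%E.
  move=> [p [pM pS]] E0.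
  have [r [delta [eps [eps_surj eps_exact delta_exact]]]] := free_resolution noethR fgM.
  have [x px] := pM 0%N (leq0n k).
  have [||||s [sg rs sp]] := @regular_of_ext R noethR M r delta eps eps_surj _ _ fgM g
    (fun r => r \in p 0%N) (prime_idealr_pred _).
  - by move=> y; apply/eps_exact; exists y.
  - by move=> i y; apply/delta_exact; exists y.
  - by exists x => c /negP pc; apply/eqP/px.
  - move=> i ig; apply: (free_ext_zero eps_surj eps_exact delta_exact) => P.
    exact: E0.
  have [t [tk rt tm]] := qid_regular noethR localR fgM resX bX (pM 0%N (leq0n k)) pS rs sp.
  rewrite -sg -tk; apply: esup_ub; first exact: fin_image.
  exists (size t) => //; exists t; split=> //; split.
    by move=> i c it /spansP st; apply/spansP; apply: rt.
  move=> /spansP s1; have pm := local_prime noethR localR.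
  case: (pm) => im m1 _; apply: m1; apply: (s1 _ im) => // y ->.
  exact: ideal0 im.
have E_ge (i : nat) (P : projective_resolution M) :
    nonzero_module (Ext i P R^o) -> (grade M <= i%:Z%:E)%E.
  by move=> nE; apply: einf_lb; [exact: fin_image|exists i => //; exists P].
have grade_ge0 : (0%:E <= grade M)%E.
  by apply: einf_ge; [exact: fin_image|move=> _ [i _ <-]; rewrite lee_fin].
(* The maximal ideal is in the support: elements outside it are units and cannot kill [e]. *)
have suppM : exists p : prime_idealr R, Defs.support M p.
  have pm := local_prime noethR localR; have [p pP] := prime_idealr_pack pm.
  exists p; exists e => s /negP ps; apply: contra e0 => /eqP se.
  have iz : ideal (@zero_submod R R^o) by apply: submod_zero.
  have [c /eqP] : adj (@zero_submod R R^o) s 1.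
    apply: contrapT => n1; apply/ps/pP.
    by apply: (local_max noethR localR (ideal_adj s iz) n1); apply: adj_mem.
  by rewrite subr_eq0 => /eqP c1; rewrite -[e]scale1r c1 -scalerA se scaler0.
have big (x : \bar int) :
    (forall k : nat, exists2 i : int, k%:Z < i & (i%:E <= x)%E) -> x = +oo%E.
  case: x => [x| |] // xP.
    by have [i xi] := xP `|x|%N; rewrite lee_fin; lia.
  by have [i _] := xP 0%N.
have fdim := @fin_image _ (fun n : nat => n%:Z).
case ed : (module_dim M) => [d| |].
- have [k] := esup_mem (fdim _) ed; move=> Hk [kd].
  case eg : (grade M) grade_ge0 E_ge => [g| |] // grade_ge0 E_ge.
    rewrite lee_fin in grade_ge0.
    have := depth_ge k `|g|%N Hk; rewrite -EFinD -kd.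
    have -> : (`|g| + k)%N%:Z = k%:Z + g by lia.
    apply=> i P ig /E_ge; rewrite lee_fin; lia.
  (* Infinite grade: all Ext modules vanish, so g is arbitrary and the depth is infinite. *)
  rewrite (big (depth m)) ?leey // => l; exists (l.+1 + k)%N%:Z; first lia.
  by apply: depth_ge => // i P _ /E_ge.
(* Infinite dim M: chains of unbounded length suffice, with g = 0. *)
- rewrite (big (depth m)) ?leey // => l.
  have [j [[k Hk [<-]] lk]] := esup_pinfty l%:Z (fdim _) ed.
  by exists k%:Z => //; apply: (depth_ge k 0%N).
- have [p pM] := suppM.
  have : (0%:E <= module_dim M)%E.
    by apply: esup_ub; [exact: fin_image|exists 0%N => //; exists (fun=> p)].
  by rewrite ed.
Qed.
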